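(* Let $M$ be a compact, connected, boundaryless $C^\infty$ Riemannian manifold and let $f:M\to M$ be a $C^1$ Anosov endomorphism such that $\Omega(f)$ is completely $f$-invariant. Then either (a) $\partial\Omega(f)=\Omega(f)$, or (b) $\partial\Omega(f)=\varnothing$, and in this case $f$ is transitive.
   Context: A continuous map $f:M\to M$ is transitive if for any nonempty open sets $U,V\subset M$ there is $n\ge 1$ with $f^n(U)\cap V\neq\varnothing$. A point $x$ is non-wandering if for every open neighborhood $V$ of $x$ there is $n\ge1$ with $f^n(V)\cap V\ne\varnothing$; $\Omega(f)$ is the set of non-wandering points, and $\partial\Omega(f)$ is its topological boundary in $M$. A set $\Lambda\subset M$ is completely $f$-invariant if $f(\Lambda)=\Lambda=f^{-1}(\Lambda)$. Anosov endomorphism: a $C^1$ local diffeomorphism $f:M\to M$ for which there are constants $C>1$, $\lambda>1$ such that along every orbit $(x_n)_{n\in\mathbb{Z}}$ of $f$ (i.e. $f(x_n)=x_{n+1}$ for all $n\in\mathbb Z$) there is a $Df$-invariant splitting $T_{x_i}M=E^s_{x_i}\oplus E^u_{x_i}$, $i\in\mathbb{Z}$ (possibly depending on the orbit), such that for all $n>0$ and all $i$: $\|Df^n_{x_i}(v^u)\|\ge C^{-1}\lambda^n\|v^u\|$ for $v^u\in E^u_{x_i}$, and $\|Df^n_{x_i}(v^s)\|\le C\lambda^{-n}\|v^s\|$ for $v^s\in E^s_{x_i}$. *)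

(* Defs.v *)
From HB Require Import structures.
From mathcomp Require Import all_boot all_order all_algebra.
From mathcomp Require Import all_classical all_reals all_analysis.

Set Implicit Arguments.
Unset Strict Implicit.
Unset Printing Implicit Defensive.

Import Order.TTheory GRing.Theory Num.Theory.
Import numFieldNormedType.Exports.

Local Open Scope classical_set_scope.
Local Open Scope ring_scope.

Section TopologicalDynamics.
Context {M : topologicalType}.
Implicit Types (f : M -> M) (A : set M).

Definition transitive_map f : Prop :=
  forall U V : set M, open U -> open V -> U !=set0 -> V !=set0 ->
  exists2 n : nat, (1 <= n)%N & (iter n f @` U) `&` V !=set0.

Definition nonwandering f : set M :=
  [set x | forall V : set M, open V -> V x ->
    exists2 n : nat, (1 <= n)%N & (iter n f @` V) `&` V !=set0].

Definition boundary A : set M := closure A `\` interior A.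

Definition completely_invariant f A : Prop := f @` A = A /\ f @^-1` A = A.

End TopologicalDynamics.

(* [U] is meant to be open, so that two-sided differentials and limits taken in
   the whole space are those of the restriction of [h] to [U]. *)
Fixpoint Ck_on {R : realType} {V W : normedModType R} (k : nat) (U : set V)
    (h : V -> W) : Prop :=
  if k is k'.+1 then
    (forall y, U y -> differentiable h y) /\
    (forall v : V, Ck_on k' U (fun y => 'd h y v))
  else forall y, U y -> {for y, continuous h}.

Definition smooth_on {R : realType} {V W : normedModType R} (U : set V)
    (h : V -> W) : Prop :=
  forall k, Ck_on k U h.

(* A homeomorphism between open sets of [M] and of R^m.  The two maps are total
   functions whose values off [chart_dom] and [chart_img] are irrelevant. *)
Record chart (R : realType) (m : nat) (M : topologicalType) := Chart {
  chart_dom : set M;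
  chart_img : set 'rV[R]_m;
  chart_map :> M -> 'rV[R]_m;
  chart_inv : 'rV[R]_m -> M;
  chart_dom_open : open chart_dom;
  chart_img_open : open chart_img;
  chart_map_img : forall x, chart_dom x -> chart_img (chart_map x);
  chart_inv_dom : forall y, chart_img y -> chart_dom (chart_inv y);
  chart_mapK : forall x, chart_dom x -> chart_inv (chart_map x) = x;
  chart_invK : forall y, chart_img y -> chart_map (chart_inv y) = y;
  chart_map_continuous : forall x, chart_dom x -> {for x, continuous chart_map};
  chart_inv_continuous : forall y, chart_img y -> {for y, continuous chart_inv}
}.

(* C^oo manifolds of dimension [m] without boundary.  The preferred chart
   [chart_at x] around each point serves only to represent the tangent space
   T_x M as R^m: a tangent vector at [x] is given by its components in
   [chart_at x]. *)
Record smooth_manifold (R : realType) (m : nat) (M : topologicalType) :=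
  SmoothManifold {
  atlas : set (chart R m M);
  chart_at : M -> chart R m M;
  chart_at_atlas : forall x, atlas (chart_at x);
  chart_at_dom : forall x, chart_dom (chart_at x) x;
  atlas_smooth : forall c d : chart R m M, atlas c -> atlas d ->
    smooth_on [set y | chart_img c y /\ chart_dom d (chart_inv c y)]
      (d \o chart_inv c);
  manifold_hausdorff : hausdorff_space M;
  manifold_second_countable : @second_countable M
}.

Section Manifold.
Context {R : realType} {m : nat} {M : topologicalType}.
Variable X : smooth_manifold R m M.

(* [U] is meant to be open. *)
Definition C1_on (U : set M) (f : M -> M) : Prop :=
  (forall x, U x -> {for x, continuous f}) /\
  forall c d : chart R m M, atlas X c -> atlas X d ->
    Ck_on 1 [set y | [/\ chart_img c y, U (chart_inv c y)
                      & chart_dom d (f (chart_inv c y))]]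
      (d \o f \o chart_inv c).

Definition local_C1_diffeomorphism (f : M -> M) : Prop :=
  forall x : M, exists (U : set M) (h : M -> M),
    [/\ open U /\ U x, open (f @` U), forall y, U y -> h (f y) = y,
        C1_on U f & C1_on (f @` U) h].

(* Df_x : T_x M -> T_(f x) M *)
Definition tangent_map (f : M -> M) (x : M) : {linear 'rV[R]_m -> 'rV[R]_m} :=
  'd (chart_at X (f x) \o f \o chart_inv (chart_at X x)) (chart_at X x x).

(* Components in [chart_at X x], where [x = chart_inv c y], of the vector of
   T_x M whose components in [c] are the argument. *)
Definition tangent_of_chart (c : chart R m M) (y : 'rV[R]_m) :
    {linear 'rV[R]_m -> 'rV[R]_m} :=
  'd (chart_at X (chart_inv c y) \o chart_inv c) y.

Definition gram (G : 'M[R]_m) (u v : 'rV[R]_m) : R := (u *m G *m v^T) 0 0.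

Record riemannian_metric := RiemannianMetric {
  metric :> M -> 'M[R]_m;
  metric_sym : forall x, (metric x)^T = metric x;
  metric_pos : forall x (v : 'rV[R]_m), v != 0 -> 0 < gram (metric x) v v;
  metric_smooth : forall c : chart R m M, atlas X c ->
    forall u v : 'rV[R]_m, smooth_on (chart_img c)
      (fun y => gram (metric (chart_inv c y))
                  (tangent_of_chart c y u) (tangent_of_chart c y v))
}.

Definition tangent_norm (g : riemannian_metric) (x : M) (v : 'rV[R]_m) : R :=
  Num.sqrt (gram (g x) v v).

Definition is_orbit (f : M -> M) (x : int -> M) : Prop :=
  forall i : int, f (x i) = x (i + 1).

Definition invariant_splitting (f : M -> M) (x : int -> M)
    (Es Eu : int -> {vspace 'rV[R]_m}) : Prop :=
  forall i : int,
    [/\ (Es i + Eu i = fullv)%VS, (Es i :&: Eu i = 0)%VS,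
        (linfun (tangent_map f (x i)) @: Es i)%VS = Es (i + 1)
      & (linfun (tangent_map f (x i)) @: Eu i)%VS = Eu (i + 1)].

Definition hyperbolic_splitting (g : riemannian_metric) (f : M -> M)
    (C lambda : R) (x : int -> M) (Es Eu : int -> {vspace 'rV[R]_m}) : Prop :=
  forall (n : nat) (i : int), (0 < n)%N ->
    (forall v, v \in Eu i ->
      C^-1 * lambda ^+ n * tangent_norm g (x i) v
        <= tangent_norm g (iter n f (x i)) (tangent_map (iter n f) (x i) v)) /\
    (forall v, v \in Es i ->
      tangent_norm g (iter n f (x i)) (tangent_map (iter n f) (x i) v)
        <= C * lambda ^- n * tangent_norm g (x i) v).

Definition anosov_endomorphism (g : riemannian_metric) (f : M -> M) : Prop :=
  [/\ C1_on setT f, local_C1_diffeomorphism f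
    & exists C lambda : R, [/\ 1 < C, 1 < lambda
      & forall x : int -> M, is_orbit f x ->
        exists Es Eu : int -> {vspace 'rV[R]_m},
          invariant_splitting f x Es Eu /\
          hyperbolic_splitting g f C lambda x Es Eu]].

End Manifold.

(* Main.v *)
Require Import Defs.
From HB Require Import structures.
From mathcomp Require Import all_boot all_order all_algebra.
From mathcomp Require Import all_classical all_reals all_analysis.
From mathcomp Require Import finmap.
From mathcomp Require Import zify lra ring.

Set Implicit Arguments.
Unset Strict Implicit.
Unset Printing Implicit Defensive.

Import Order.TTheory GRing.Theory Num.Theory.
Import numFieldNormedType.Exports.

Local Open Scope classical_set_scope.
Local Open Scope ring_scope.

(** The dynamics enters through a single property of [f], stated as
    [asymptotic_shadowing]: a bi-infinite sequence with small jumps is followed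
    closely by a genuine orbit, and wherever the sequence stops jumping, in the
    far future or in the far past, that orbit is asymptotic to it.

    Shadowing is proved by a Newton iteration ([newton_shadowing]).  Read in
    finitely many charts along a pseudo-orbit, correcting the jumps [e i] to
    first order means solving [v (i + 1) - A i (v i) = e i], where [A i] is the
    derivative of [f].  Along a true orbit a single jump [e] at time [j] has an
    explicit response: push the stable component of [e] forward and pull its
    unstable component back.  Both parts decay exponentially, so the response
    may be cut off outside a window of length [T] around [j] at a small cost
    ([hyperbolic_impulse]).  Over such a window a pseudo-orbit with very small
    jumps is close to a true orbit, hence the same response still works up to a
    small relative error ([pseudo_orbit_impulses]).  Adding the responses to all
    jumps gives an approximate inverse with relative error 1/4
    ([assemble_impulses]), and each Newton step halves the jumps.  The inverse
    is local: the correction at time [i] only sees the jumps at times within [T]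
    of [i].  So the first [n] steps do not move a point whose time is further
    than [n * (T + 1)] from all jumps, which gives the asymptotic statement
    together with the orbit.

    The conclusion then follows by topology ([nonwandering_dichotomy]).  Write
    [x ~> y] ([leads_to]) when finite pseudo-orbits with arbitrarily small jumps
    go from [x] to [y].  By shadowing, nonwandering means [x ~> x].  If the
    nonwandering set is everything, then the points reached from [x] with jumps
    below a fixed size form a clopen set, which is all of [M] by connectedness;
    shadowing such chains gives transitivity.  Now suppose that [u0] is
    interior to the nonwandering set, and let [K] be the set of [y] with
    [u0 ~> y] and [y ~> u0].  It is closed.  It is open too: let [y] be close to
    a point [x] of [K].  A chain from [u0] to [x], redirected to [y] by its last
    jump and continued by the orbit of [y], is shadowed by an orbit [z] that
    starts near [u0], hence at a nonwandering point equivalent to [u0], and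
    ends up asymptotic to the orbit of [y]; complete invariance keeps the whole
    orbit [z] in the nonwandering set, so [y ~> u0].  Running from the past of
    [y] through a chain from [x] to [u0] gives [u0 ~> y] in the same way.
    Hence [K = M] ([interior_nonwandering_full]).  So either the nonwandering
    set has empty interior, and equals its boundary, or it is all of [M]. *)

(** * Geometric decay *)

Lemma geometric_small (R : realType) (z C e : R) : 0 <= z < 1 -> 0 < e ->
  exists N : nat, forall n, (N <= n)%N -> C * z ^+ n < e.
Proof.
move=> /andP[z0 z1] e0.
have h : (fun n => C * z ^+ n) @ \oo --> C * 0.
  by apply: cvgMr; apply: cvg_expr; rewrite ger0_norm.
rewrite mulr0 in h.
have [N _ hN] := cvgr_lt _ h _ e0.
by exists N => n /hN.
Qed.

Lemma le_geometric_le0 (R : realType) (x C : R) :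
  (forall n, x <= C * (2^-1) ^+ n) -> x <= 0.
Proof.
move=> h; rewrite leNgt; apply/negP => x0.
have [N hN] : exists N : nat, forall n, (N <= n)%N -> C * 2^-1 ^+ n < x.
  by apply: geometric_small => //; lra.
by have := hN N (leqnn _); have := h N; lra.
Qed.

(** The linear factor is absorbed by writing [mu = nu ^+ 2]: Bernoulli's
    inequality bounds [n * nu ^+ n], and the other factor [nu ^+ n] tends to 0. *)
Lemma linear_geometric_small (R : realType) (mu B e : R) : 0 < mu < 1 -> 0 < B -> 0 < e ->
  exists2 T, (0 < T)%N & (2 * T + 2)%:R * (B * mu ^+ T) < e.
Proof.
move=> /andP[mu0 mu1] B0 e0.
pose nu := Num.sqrt mu.
have nu0 : 0 < nu by rewrite sqrtr_gt0.
have nu1 : nu < 1 by rewrite -sqrtr1 ltr_sqrt.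
have muE : mu = nu * nu by rewrite -expr2 sqr_sqrtr ?ltW.
pose h := 1 - nu; have h0 : 0 < h by rewrite subr_gt0.
have bern n : (n%:R * h) * nu ^+ n <= 1 - nu ^+ n.
  elim: n => [|n IH]; first by rewrite mul0r mul0r expr0 subrr.
  have p0 : 0 <= nu ^+ n by rewrite exprn_ge0 ?ltW.
  have p1 : nu ^+ n <= 1 by rewrite exprn_ile1 ?ltW.
  have n0 : 0 <= n%:R :> R by [].
  rewrite -addn1 natrD exprD expr1 /h in IH *.
  have := ler_wpM2l (ltW nu0) IH.
  have : (1 - nu) * (1 - nu ^+ n) >= 0 by apply: mulr_ge0; lra.
  have : (1 - nu) * (1 - nu) * nu ^+ n >= 0 by rewrite !mulr_ge0 //; lra.
  nra.
have [N hN] : exists N : nat, forall n, (N <= n)%N -> (2 / h + 2) * B * nu ^+ n < e.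
  by apply: geometric_small => //; rewrite nu1 ltW.
exists N.+1 => //; have := hN N.+1 (leqnSn N).
apply: le_lt_trans; rewrite muE exprMn.
set p := nu ^+ N.+1.
have p0 : 0 <= p by rewrite exprn_ge0 ?ltW.
have p1 : p <= 1 by rewrite exprn_ile1 ?ltW.
have b1 : N.+1%:R * p <= h^-1.
  rewrite -(ler_pM2r h0) mulVf ?gt_eqF //; have := bern N.+1; rewrite -/p; lra.
have b2 : (2 * N.+1 + 2)%:R * p <= 2 / h + 2.
  by rewrite natrD natrM; lra.
have Bp : 0 <= B * p by exact: mulr_ge0 (ltW B0) p0.
have -> : (2 * N.+1 + 2)%:R * (B * (p * p)) = (2 * N.+1 + 2)%:R * p * (B * p) by ring.
by rewrite -[leRHS]mulrA; exact: (ler_wpM2r Bp b2).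
Qed.

(** * Pseudo-orbits, chains and shadowing *)

(** A manifold is given here as a bare topological space; a distance that
    induces its topology is carried as a function with these properties. *)
Record compatible_metric (R : realType) (M : topologicalType) (d : M -> M -> R) :
    Prop := CompatibleMetric {
  dist_refl : forall x, d x x = 0;
  dist_sym : forall x y, d x y = d y x;
  dist_triangle : forall x y z, d x z <= d x y + d y z;
  dist_nbhs : forall x (U : set M),
    nbhs x U <-> exists2 e, 0 < e & forall y, d x y < e -> U y
}.

Section Orbits.
Variables (M : Type) (f : M -> M).

Lemma full_orbit_through : (forall y, exists x, f x = y) ->
  forall x, exists2 a : int -> M, (forall i, f (a i) = a (i + 1)) & a 0 = x.
Proof.
move=> /choice[g fg] x.
exists (fun i => match i with Posz k => iter k f x | Negz k => iter k.+1 g x end) => //.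
case=> [k|[|k]].
- by rewrite -PoszD addn1.
- by rewrite /= fg.
- have -> : Negz k.+1 + 1 = Negz k by lia.
  by rewrite iterS fg.
Qed.

End Orbits.

Lemma orbit_iter (M : topologicalType) (f : M -> M) (a : int -> M) (i : int) (n : nat) :
  is_orbit f a -> iter n f (a i) = a (i + n%:Z).
Proof.
move=> oa; elim: n => [|n IH]; first by rewrite addr0.
by rewrite iterS IH oa -addrA -PoszD addn1.
Qed.

Section Shadowing.
Context {R : realType} {M : topologicalType}.
Variables (d : M -> M -> R) (f : M -> M).

Definition pseudo_orbit (e : R) (x : int -> M) :=
  forall i, d (f (x i)) (x (i + 1)) < e.

(** The asymptotic clauses allow chains with arbitrarily small jumps to pass from
    the shadowing orbit to the exact parts of [x], although [x] itself is only
    [e]-close to that orbit elsewhere. *)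
Definition asymptotic_shadowing :=
  forall e, 0 < e -> exists2 del, 0 < del & forall x, pseudo_orbit del x ->
  exists z, [/\ is_orbit f z,
    forall i, d (x i) (z i) < e,
    forall i0, (forall i, i0 <= i -> f (x i) = x (i + 1)) ->
      forall eta, 0 < eta -> exists i1, forall i, i1 <= i -> d (x i) (z i) < eta &
    forall i0, (forall i, i <= i0 -> f (x i) = x (i + 1)) ->
      forall eta, 0 < eta -> exists i1, forall i, i <= i1 -> d (x i) (z i) < eta].

Definition chain (del : R) (n : nat) (x y : M) :=
  exists c : nat -> M, [/\ c 0%N = x, c n = y &
    forall i, (i < n)%N -> d (f (c i)) (c i.+1) < del].

Definition leads_to (x y : M) :=
  forall del, 0 < del -> exists2 n, (0 < n)%N & chain del n x y.

Hypothesis d_metric : compatible_metric d.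

Lemma dist_near x e : 0 < e -> \forall y \near x, d x y < e.
Proof. by move=> e0; apply/(dist_nbhs d_metric); exists e. Qed.

Lemma dist_ball_open x e : open [set y | d x y < e].
Proof.
rewrite openE => y /= xy; apply/(dist_nbhs d_metric); exists (e - d x y).
  by rewrite subr_gt0.
by move=> z yz /=; have := dist_triangle d_metric x y z; lra.
Qed.

Lemma closed_dist (A : set M) :
  (forall y, (forall e, 0 < e -> exists2 x, A x & d y x < e) -> A y) -> closed A.
Proof.
move=> h y clAy; apply: h => e e0.
by have [x [Ax /= yx]] := clAy _ (dist_near y e0); exists x.
Qed.

Lemma chain_cat del n1 n2 x y z :
  chain del n1 x y -> chain del n2 y z -> chain del (n1 + n2) x z.
Proof.
move=> [c1 [c10 c1n h1]] [c2 [c20 c2n h2]].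
exists (fun i => if (i < n1)%N then c1 i else c2 (i - n1)%N); split.
- case: n1 c1n h1 => [|n1] //=.
  by rewrite c10 c20 => ->.
- by rewrite ltnNge leq_addr /= addKn.
move=> i iln; case: ltnP => [i1|i1].
  case: (ltnP i.+1 n1) => i1'; first exact: h1.
  have e : i.+1 = n1 by lia.
  by rewrite e subnn c20 -c1n -e; exact: h1.
rewrite ltnNge (leq_trans i1)//= subSn//; apply: h2; lia.
Qed.

Lemma leads_to_trans x y z : leads_to x y -> leads_to y z -> leads_to x z.
Proof.
move=> xy yz del del0; have [n n0 cn] := xy _ del0; have [k k0 ck] := yz _ del0.
by exists (n + k)%N; [rewrite addn_gt0 n0|exact: chain_cat cn ck].
Qed.

Lemma chain_step del x y : d (f x) y < del -> chain del 1 x y.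
Proof.
move=> xy; exists (fun i => if i == 0%N then x else y); split => //.
by case.
Qed.

Lemma leads_to_image x : leads_to x (f x).
Proof.
by move=> del del0; exists 1%N => //; apply: chain_step; rewrite (dist_refl d_metric).
Qed.

Lemma chain_last del1 del2 n x y y' : (0 < n)%N -> del1 <= del2 ->
  chain del1 n x y -> d y y' < del2 - del1 -> chain del2 n x y'.
Proof.
move=> n0 le12 [c [c0 cn h]] yy'.
exists (fun i => if i == n then y' else c i); split => //.
- by case: eqP => // e; move: n0; rewrite -e.
- by rewrite eqxx.
move=> i iln; rewrite (ltn_eqF iln); have := h _ iln; case: eqP => [e|_].
  by have := dist_triangle d_metric (f (c i)) y y'; rewrite e cn; lra.
lra.
Qed.

Lemma chain_first del1 del2 n x x' y : (0 < n)%N -> del1 <= del2 ->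
  chain del1 n x y -> d (f x') (f x) < del2 - del1 -> chain del2 n x' y.
Proof.
move=> n0 le12 [c [c0 cn h]] xx'.
exists (fun i => if i == 0%N then x' else c i); split => //.
- by case: eqP => // e; move: n0; rewrite e.
move=> i iln; have := h _ iln; case: i iln => [|i] /=.
  by have := dist_triangle d_metric (f x') (f x) (c 1%N); rewrite c0; lra.
by move=> _; lra.
Qed.

Hypothesis f_cont : continuous f.

Lemma continuous_dist x e : 0 < e ->
  exists2 del, 0 < del & forall y, d x y < del -> d (f x) (f y) < e.
Proof.
move=> e0; apply/(dist_nbhs d_metric x [set y | d (f x) (f y) < e]).
exact: (f_cont (dist_near (f x) e0)).
Qed.

Lemma closed_leads_to_r x : closed [set y | leads_to x y].
Proof.
apply: closed_dist => y h del del0.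
have del20 : 0 < del / 2 by lra.
have [y' xy' yy'] := h _ del20; have [n n0 cn] := xy' _ del20.
exists n => //; apply: chain_last cn _ => //; first lra.
by rewrite (dist_sym d_metric); lra.
Qed.

Lemma closed_leads_to_l y : closed [set x | leads_to x y].
Proof.
apply: closed_dist => x h del del0.
have del20 : 0 < del / 2 by lra.
have [r r0 hr] := continuous_dist x del20.
have [x' x'y xx'] := h _ r0; have [n n0 cn] := x'y _ del20.
exists n => //; apply: chain_first cn _ => //; first lra.
by have := hr _ xx'; lra.
Qed.

(** Start a closed chain at [q], traverse it twice so that it has at least two
    jumps, and drop its first step: it then starts close to [f q]. *)
Lemma leads_to_from_image q : leads_to q q -> leads_to (f q) q.
Proof.
move=> qq del del0; have del20 : 0 < del / 2 by lra.
have [r r0 hr] := continuous_dist (f q) del20.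
set e := Num.min r (del / 2).
have e0 : 0 < e by rewrite /e lt_min r0.
have [n n0 cn] := qq _ e0.
have [c [c0 cn' h]] := chain_cat cn cn.
have n1 : (1 < n + n)%N by lia.
exists (n + n).-1; first lia.
apply: (@chain_first (del / 2) del _ (c 1%N)); [lia|lra| |].
- exists (fun i => c i.+1); split => //; first by rewrite prednK //; lia.
  move=> i ilt; have /h : (i.+1 < n + n)%N by lia.
  by move/lt_le_trans; apply; rewrite /e ge_min lexx orbT.
have /h : (0 < n + n)%N by lia.
rewrite c0 => fq.
have /hr : d (f q) (c 1%N) < r by apply: (lt_le_trans fq); rewrite /e ge_min lexx.
lra.
Qed.

Lemma nonwandering_leads_to x : nonwandering f x -> leads_to x x.
Proof.
move=> nx del del0; have del30 : 0 < del / 3 by lra.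
have [r r0 hr] := continuous_dist x del30.
set e := Num.min r (del / 3).
have e0 : 0 < e by rewrite /e lt_min r0.
have [n n0 [w [[v /= xv vw] /= xw]]] :=
  nx [set y | d x y < e] (dist_ball_open x e) ltac:(by rewrite /= (dist_refl d_metric)).
have xvr : d x v < r by apply: (lt_le_trans xv); rewrite /e ge_min lexx.
have xwd : d x w < del / 3 by apply: (lt_le_trans xw); rewrite /e ge_min lexx orbT.
exists n => //.
apply: (@chain_first (2 * del / 3) del _ v); [by []|lra| |by have := hr _ xvr; lra].
apply: (@chain_last (del / 3) (2 * del / 3) _ _ w); [by []|lra| |].
  exists (fun i => iter i f v); split => // i _.
  by rewrite -iterS (dist_refl d_metric).
by rewrite (dist_sym d_metric); lra.
Qed.

Lemma closed_nonwandering : closed (nonwandering f).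
Proof.
move=> x clx V oV Vx.
have [y [ny Vy]] := clx V (open_nbhs_nbhs (conj oV Vx)).
exact: ny Vy.
Qed.

Hypothesis f_shadow : asymptotic_shadowing.

(** The pseudo-orbit used in every application of shadowing: the past of [a 0],
    then a chain to [b 0], then the future of [b 0].  Its jumps are those of the
    chain, so the shadowing orbit is asymptotic to [a] in the past and to [b] in
    the future. *)
Lemma shadow_bridge e : 0 < e -> exists2 del, 0 < del &
  forall (a b : int -> M) n, is_orbit f a -> is_orbit f b ->
  chain del n (a 0) (b 0) ->
  exists z, [/\ is_orbit f z, d (a 0) (z 0) < e, d (b 0) (z n%:Z) < e,
    forall eta, 0 < eta -> exists N : nat, forall k : nat, (N <= k)%N ->
      d (a (- k%:Z)) (z (- k%:Z)) < eta &
    forall eta, 0 < eta -> exists N : nat, forall k : nat, (N <= k)%N ->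
      d (b k%:Z) (z (k%:Z + n%:Z)) < eta].
Proof.
move=> e0; have [del del0 sh] := f_shadow e0; exists del => //.
move=> a b n oa ob [c [c0 cn hc]].
pose w i := if i < 0 then a i else if i < n%:Z then c `|i|%N else b (i - n%:Z).
have wa i : i < 0 -> w i = a i by rewrite /w => ->.
have wc k : (k <= n)%N -> w k%:Z = c k.
  move=> kn; rewrite /w ltNge /=; case: ifPn => // kn'.
  have -> : k = n by lia.
  by rewrite subrr cn.
have wb i : n%:Z <= i -> w i = b (i - n%:Z).
  by move=> ni; rewrite /w !ltNge ni /= ifF //; lia.
have fwa i : i < 0 -> f (w i) = w (i + 1).
  move=> i0; rewrite wa// oa; have [i1|i1] := ltP (i + 1) 0; first by rewrite wa.
  have -> : i + 1 = 0%:Z by lia.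
  by rewrite wc // c0.
have fwb i : n%:Z <= i -> f (w i) = w (i + 1).
  by move=> ni; rewrite !wb ?ob; [congr b; lia|lia|].
have pw : pseudo_orbit del w.
  move=> i; have [i0|i0] := ltP i 0; first by rewrite fwa// (dist_refl d_metric).
  have [ni|ni] := leP n%:Z i; first by rewrite fwb// (dist_refl d_metric).
  case: i i0 ni => // k _ kn; rewrite -PoszD addn1 !wc; [|lia|lia].
  by apply: hc; lia.
have [z [oz dz zp zn]] := sh w pw.
exists z; split => //.
- by have := dz 0%:Z; rewrite wc // c0.
- by have := dz n; rewrite wc // cn.
- move=> eta eta0; have [i1 h1] : exists i1, forall i, i <= i1 -> d (w i) (z i) < eta.
    apply: (zn (-1)) => // i i1; apply: fwa; lia.
  exists `|i1|.+1%N => k hk; rewrite -wa; last lia.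
  by apply: h1; lia.
- move=> eta eta0; have [i1 h1] := zp n%:Z fwb eta eta0.
  exists `|i1|%N => k hk; have -> : b k = w (k%:Z + n%:Z).
    by rewrite wb; [congr b; lia|lia].
  by apply: h1; lia.
Qed.

End Shadowing.

(** * The dichotomy for maps with asymptotic shadowing *)

Lemma clopen_setT (M : topologicalType) (A : set M) : connected [set: M] ->
  A !=set0 -> open A -> closed A -> A = setT.
Proof.
move=> cM A0 oA cA; apply: cM => //; first by exists A => //; rewrite setTI.
by exists A => //; rewrite setTI.
Qed.

Section Dichotomy.
Context {R : realType} {M : topologicalType}.
Variables (d : M -> M -> R) (f : M -> M).
Hypothesis d_metric : compatible_metric d.
Hypothesis f_cont : continuous f.
Hypothesis f_surj : forall y, exists x, f x = y.
Hypothesis f_shadow : asymptotic_shadowing d f.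
Hypothesis M_connected : connected [set: M].

Let open_dist (A : set M) :
  (forall x, A x -> exists2 e, 0 < e & forall y, d x y < e -> A y) -> open A.
Proof. by move=> h; rewrite openE => x /h /(dist_nbhs d_metric). Qed.

Lemma chain_shadowed x y (U V : set M) : leads_to d f x y -> nbhs x U -> nbhs y V ->
  exists2 n : nat, (1 <= n)%N & (iter n f @` U) `&` V !=set0.
Proof.
move=> xy /(dist_nbhs d_metric)[e1 e10 hU] /(dist_nbhs d_metric)[e2 e20 hV].
have e0 : 0 < Num.min e1 e2 by rewrite lt_min e10.
have [del del0 hdel] := shadow_bridge d_metric f_shadow e0.
have [n n0 cn] := xy _ del0.
have [a oa a0] := full_orbit_through f_surj x.
have [b ob b0] := full_orbit_through f_surj y.
have := hdel a b n oa ob; rewrite a0 b0 => /(_ cn)[z [oz xz yz _ _]].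
exists n => //; exists (z n%:Z); split.
  exists (z 0); last by rewrite orbit_iter // add0r.
  by apply: hU; apply: (lt_le_trans xz); rewrite ge_min lexx.
by apply: hV; apply: (lt_le_trans yz); rewrite ge_min lexx orbT.
Qed.

Lemma leads_to_nonwandering x : leads_to d f x x -> nonwandering f x.
Proof.
by move=> xx V oV Vx; apply: (chain_shadowed xx); apply: open_nbhs_nbhs.
Qed.

(** For a fixed jump size, the set of points reached from [x] is open because
    the last jump can be adjusted, and closed because a point close to a reached
    point [y'] can borrow the first jump of its own closed chain. *)
Lemma all_nonwandering_transitive : nonwandering f = setT -> transitive_map f.
Proof.
move=> OmT.
have self y : leads_to d f y y.
  by apply: (nonwandering_leads_to d_metric f_cont); rewrite OmT.
have allx x del : 0 < del -> [set y | exists2 n, (0 < n)%N & chain d f del n x y] = setT.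
  move=> del0; apply: clopen_setT => //.
  - by have [n n0 cn] := self x _ del0; exists x, n.
  - apply: open_dist => y [n n0 [c [c0 cn h]]].
    have lty : d (f (c n.-1)) y < del by rewrite -cn -{2}(prednK n0); apply: h; lia.
    exists (del - d (f (c n.-1)) y); first by rewrite subr_gt0.
    move=> y' yy'; exists n => //.
    exists (fun i => if i == n then y' else c i); split => //.
    + by case: eqP => // e; move: n0; rewrite -e.
    + by rewrite eqxx.
    move=> i iln; rewrite (ltn_eqF iln); case: eqP => [e|_]; last exact: h.
    have -> : i = n.-1 by lia.
    by have := dist_triangle d_metric (f (c n.-1)) y y'; lra.
  - apply: (closed_dist d_metric) => y h.
    have del20 : 0 < del / 2 by lra.
    have [r r0 hr] := continuous_dist d_metric f_cont y del20.
    have [y' [n n0 cn] yy'] := h r r0.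
    have [k k0 ck] := self y _ del20.
    exists (n + k)%N; first lia.
    apply: (chain_cat cn); apply: (chain_first d_metric k0 _ ck); first lra.
    by rewrite (dist_sym d_metric); have := hr _ yy'; lra.
move=> U V oU oV [x Ux] [y Vy].
apply: (@chain_shadowed x y); try exact: open_nbhs_nbhs.
by move=> del del0; have : setT y by []; rewrite -(allx x del del0).
Qed.

Hypothesis Omega_invariant : completely_invariant f (nonwandering f).

Lemma orbit_nonwandering (a : int -> M) i j : is_orbit f a ->
  nonwandering f (a i) -> nonwandering f (a j).
Proof.
move=> oa.
have step k : nonwandering f (a k) <-> nonwandering f (a (k + 1)).
  have [_ e] := Omega_invariant.
  by rewrite -oa -{1}e.
have up k (n : nat) : nonwandering f (a k) <-> nonwandering f (a (k + n%:Z)).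
  elim: n => [|n IH]; first by rewrite addr0.
  by rewrite IH step -addrA -PoszD addn1.
have [ij|ji] := leP i j.
  have -> : j = i + `|j - i|%N%:Z by lia.
  by move/up.
have -> : i = j + `|i - j|%N%:Z by lia.
by case: (up j `|i - j|%N).
Qed.

(** Complete invariance puts the whole orbit in the nonwandering set, where each
    step can be undone up to small jumps by [leads_to_from_image]. *)
Lemma orbit_leads_to (a : int -> M) i0 i j : is_orbit f a ->
  nonwandering f (a i0) -> leads_to d f (a i) (a j).
Proof.
move=> oa na0.
have na k : nonwandering f (a k) by apply: (orbit_nonwandering oa na0).
have self k : leads_to d f (a k) (a k) by apply: nonwandering_leads_to.
have up k (n : nat) :
    leads_to d f (a k) (a (k + n%:Z)) /\ leads_to d f (a (k + n%:Z)) (a k).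
  elim: n => [|n [IH1 IH2]]; first by rewrite addr0.
  have -> : k + n.+1%:Z = k + n%:Z + 1 by lia.
  rewrite -oa; split.
    by apply: leads_to_trans IH1 _; apply: leads_to_image.
  by apply: leads_to_trans IH2; apply: leads_to_from_image.
have [ij|ji] := leP i j.
  have -> : j = i + `|j - i|%N%:Z by lia.
  by case: (up i `|j - i|%N).
have -> : i = j + `|i - j|%N%:Z by lia.
by case: (up j `|i - j|%N).
Qed.

(** Following [z] until it is close to [a] in the far past and then following
    the orbit [a] up to time 0 is a chain. *)
Lemma leads_to_from_past (a z : int -> M) w :
  is_orbit f a -> is_orbit f z ->
  (forall k : int, leads_to d f w (z k)) ->
  (forall eta, 0 < eta -> exists N : nat, forall k : nat, (N <= k)%N ->
      d (a (- k%:Z)) (z (- k%:Z)) < eta) -> leads_to d f w (a 0).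
Proof.
move=> oa oz wz h del del0.
have del20 : 0 < del / 2 by lra.
have [N hN] := h _ del20.
have [n n0 cn] := wz (- N.+1%:Z) _ del20.
exists (n + N.+1)%N; first lia.
apply: (@chain_cat _ _ _ _ _ _ _ _ (a (- N.+1%:Z))).
  apply: (chain_last d_metric n0 _ cn); first lra.
  by have := hN N.+1 ltac:(lia); rewrite (dist_sym d_metric); lra.
exists (fun i => iter i f (a (- N.+1%:Z))); split => //.
  by rewrite orbit_iter // addNr.
by move=> i _; rewrite -iterS (dist_refl d_metric).
Qed.

Lemma leads_to_from_future (b z : int -> M) w (m : int) :
  is_orbit f b -> is_orbit f z ->
  (forall k : int, leads_to d f (z k) w) ->
  (forall eta, 0 < eta -> exists N : nat, forall k : nat, (N <= k)%N ->
      d (b k%:Z) (z (k%:Z + m)) < eta) -> leads_to d f (b 0) w.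
Proof.
move=> ob oz zw h del del0.
have del20 : 0 < del / 2 by lra.
have [N hN] := h _ del20.
have [n n0 cn] := zw (N.+1%:Z + m) _ del20.
exists (N.+1 + n)%N; first lia.
apply: (@chain_cat _ _ _ _ _ _ _ _ (z (N.+1%:Z + m))).
  exists (fun i => if i == N.+1 then z (N.+1%:Z + m) else iter i f (b 0)); split => //.
    by rewrite eqxx.
  move=> i iN; rewrite (ltn_eqF iN) -iterS; case: eqP => [->|_].
    by rewrite orbit_iter // add0r; have := hN N.+1 ltac:(lia); lra.
  by rewrite (dist_refl d_metric).
have [c [c0 cn' hc]] := cn; exists c; split => // i /hc; lra.
Qed.

(** A single small jump from the past of [x] to the future of [y] is shadowed by
    an orbit that comes from the past of [x] and goes to the future of [y];
    nonwandering points are equivalent to their past and future. *)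
Lemma near_nonwandering_leads_to : exists2 eta, 0 < eta &
  forall x y, nonwandering f x -> nonwandering f y -> d x y < eta -> leads_to d f x y.
Proof.
have [del del0 hdel] := shadow_bridge d_metric f_shadow (@ltr01 R).
exists del => // x y nx ny xy.
have [u ou u0] := full_orbit_through f_surj x.
have [b ob b0] := full_orbit_through f_surj y.
pose a i := u (i - 1).
have oa : is_orbit f a by move=> i; rewrite /a ou; congr u; lia.
have nu k : nonwandering f (u k) by apply: (@orbit_nonwandering u 0) => //; rewrite u0.
have nb k : nonwandering f (b k) by apply: (@orbit_nonwandering b 0) => //; rewrite b0.
have c1 : chain d f del 1 (a 0) (b 0).
  by apply: chain_step; rewrite /a ou sub0r addNr u0 b0.
have [z [oz _ _ past fut]] := hdel a b 1%N oa ob c1.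
have az (k : int) : leads_to d f (u 0) (z k).
  rewrite -[k]add0r.
  apply: (@leads_to_from_past (fun i => z (i + k)) (fun i => a (i + k))).
  - by move=> i; rewrite oz; congr z; lia.
  - by move=> i; rewrite oa; congr a; lia.
  - by move=> i; apply: (orbit_leads_to _ _ ou (nu 0)).
  move=> e e0; have [N hN] := past _ e0; exists (N + `|k|)%N => n hn.
  have -> : - n%:Z + k = - `|n%:Z - k|%N%:Z by lia.
  by rewrite (dist_sym d_metric); apply: hN; lia.
have yk (k : int) : leads_to d f (b k) (b 0) by apply: (@orbit_leads_to b 0) => //; exact: nb.
rewrite -u0 -b0 => e e0.
have e20 : 0 < e / 2 by lra.
have [N hN] := fut _ e20.
have [n n0 cn] := az (N%:Z + 1) _ e20.
have [n' n'0 cn'] := yk N%:Z _ e0.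
exists (n + n')%N; first lia.
apply: (chain_cat _ cn').
apply: (chain_last d_metric n0 _ cn); first lra.
by have := hN N (leqnn _); rewrite (dist_sym d_metric); lra.
Qed.

(** The class [K] of an interior point [u0] is clopen.  Its openness is where
    the interior is used: a shadowing orbit that passes near [u0] passes through
    a nonwandering point equivalent to [u0], hence consists of such points. *)
Lemma interior_nonwandering_full :
  interior (nonwandering f) !=set0 -> nonwandering f = setT.
Proof.
move=> [u0 /(dist_nbhs d_metric)[r r0 hr]].
have nu0 : nonwandering f u0 by apply: hr; rewrite (dist_refl d_metric).
have [eta eta0 heta] := near_nonwandering_leads_to.
pose K := [set y | leads_to d f u0 y /\ leads_to d f y u0].
suff KT : K = setT.
  rewrite -subTset => x _; apply: leads_to_nonwandering.
  have [h1 h2] : K x by rewrite KT.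
  exact: leads_to_trans h2 h1.
have e0 : 0 < Num.min r eta by rewrite lt_min r0.
have [del del0 hdel] := shadow_bridge d_metric f_shadow e0.
have near_u0 p : d u0 p < Num.min r eta -> [/\ nonwandering f p, leads_to d f u0 p & leads_to d f p u0].
  move=> up; have np : nonwandering f p by apply: hr; apply: (lt_le_trans up); rewrite ge_min lexx.
  have upe : d u0 p < eta by apply: (lt_le_trans up); rewrite ge_min lexx orbT.
  by split => //; apply: heta => //; rewrite (dist_sym d_metric).
have [u ou ue] := full_orbit_through f_surj u0.
apply: clopen_setT => //.
- by exists u0; split; apply: nonwandering_leads_to.
- apply: open_dist => x [ux xu].
  have del20 : 0 < del / 2 by lra.
  have [s s0 hs] := continuous_dist d_metric f_cont x del20.
  exists (Num.min s (del / 2)); first by rewrite lt_min s0.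
  move=> y xy.
  have xys : d x y < s by apply: (lt_le_trans xy); rewrite ge_min lexx.
  have xyd : d x y < del / 2 by apply: (lt_le_trans xy); rewrite ge_min lexx orbT.
  have [b ob be] := full_orbit_through f_surj y.
  have [n1 n10 c1] := ux _ del20; have [n2 n20 c2] := xu _ del20.
  have c1' : chain d f del n1 (u 0) (b 0).
    by rewrite ue be; apply: (chain_last d_metric n10 _ c1); lra.
  have c2' : chain d f del n2 (b 0) (u 0).
    rewrite ue be; apply: (chain_first d_metric n20 _ c2); first lra.
    by rewrite (dist_sym d_metric); have := hs _ xys; lra.
  have [z [oz + _ _ fut]] := hdel _ _ _ ou ob c1'.
  have [z' [oz' _ + past _]] := hdel _ _ _ ob ou c2'.
  rewrite ue => /near_u0[nz' uz' z'u] /near_u0[nz uz zu].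
  split; rewrite -be.
    apply: (leads_to_from_past ob oz' _ past) => k.
    by apply: leads_to_trans uz' _; apply: (orbit_leads_to _ _ oz' nz').
  apply: (leads_to_from_future ob oz _ fut) => k.
  by apply: leads_to_trans zu; apply: (orbit_leads_to _ _ oz nz).
- apply: closedI.
    exact: (closed_leads_to_r d_metric).
  exact: (closed_leads_to_l d_metric).
Qed.

(** A cluster point of a forward orbit is visited infinitely often in each of its
    neighbourhoods. *)
Lemma nonwandering_nonempty : compact [set: M] -> M -> nonwandering f !=set0.
Proof.
move=> cM x.
have [p [_ clp]] := cM ((fun n => iter n f x) @ \oo) _ filterT.
exists p => V oV Vp; have nV := open_nbhs_nbhs (conj oV Vp).
have visit N : exists2 n, (N <= n)%N & V (iter n f x).
  have tail : ((fun n => iter n f x) @ \oo) [set iter n f x | n in [set n | (N <= n)%N]].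
    by exists N => // n /= Nn; exists n.
  by have [_ [[n Nn <-] Vn]] := clp _ _ tail nV; exists n.
have [n1 _ V1] := visit 0%N; have [n2 n12 V2] := visit n1.+1.
exists (n2 - n1)%N; first lia.
exists (iter n2 f x); split => //; exists (iter n1 f x) => //.
by rewrite -iterD subnK //; lia.
Qed.

Theorem nonwandering_dichotomy (M_compact : compact [set: M]) :
  (boundary (nonwandering f) = nonwandering f \/
   boundary (nonwandering f) = set0) /\
  (boundary (nonwandering f) = set0 -> transitive_map f).
Proof.
have bdE : boundary (nonwandering f) = nonwandering f `\` interior (nonwandering f).
  by rewrite /boundary -(closure_id _).1 //; apply: closed_nonwandering.
have [intO|/nonemptyPn intO] := pselect (interior (nonwandering f) !=set0).
  have OT := interior_nonwandering_full intO.
  split; last by move=> _; exact: all_nonwandering_transitive.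
  by right; rewrite bdE OT interiorT setDv.
have bdO : boundary (nonwandering f) = nonwandering f by rewrite bdE intO setD0.
split; first by left.
rewrite bdO => O0 U V _ _ [x _] _.
by have [p] := nonwandering_nonempty M_compact x; rewrite O0.
Qed.

End Dichotomy.

(** * Newton iteration along a pseudo-orbit *)

(** [G] is an approximate right inverse, with relative error 1/4, of the operator
    [v |-> v (i + 1) - A i (v i)] on bounded sequences, and it is local: its
    output at [i] depends on its input within distance [T] of [i].  The maps
    [A i] are the derivatives at the initial pseudo-orbit [xi] and are not
    updated during the iteration; the remainder [theta] accounts for that. *)
Section Newton.
Context {R : realType} {m : nat}.
Local Notation V := 'rV[R]_m.
Variables (phi A : int -> V -> V) (xi : int -> V) (G : (int -> V) -> int -> V).
Variables (r K theta del : R) (T : nat).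
Hypothesis A_bounded : forall i, exists L, forall v, `|A i v| <= L * `|v|.
Hypothesis phi_approx : forall i x y, `|x - xi i| < r -> `|y - xi i| < r ->
  `|phi i x - phi i y - A i (x - y)| <= theta * `|x - y|.
Hypothesis G_bounded : forall e eta, (forall i, `|e i| <= eta) ->
  forall i, `|G e i| <= K * eta.
Hypothesis G_inverse : forall e eta, (forall i, `|e i| <= eta) ->
  forall i, `|G e (i + 1) - A i (G e i) - e i| <= eta / 4.
Hypothesis G_local : forall e (i : int),
  (forall j : int, (`|j - i| <= T)%N -> e j = 0) -> G e i = 0.
Hypothesis K0 : 0 <= K.
Hypothesis del0 : 0 <= del.
Hypothesis theta0 : 0 <= theta.
Hypothesis small_theta : K * theta <= 1 / 4.
Hypothesis small_del : 2 * K * del < r.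
Hypothesis xi_pseudo : forall i, `|phi i (xi i) - xi (i + 1)| <= del.

Let err (z : int -> V) (i : int) := phi i (z i) - z (i + 1).
Let st := fix st n : int -> V :=
  if n is n'.+1 then fun i => st n' i + G (err (st n')) i else xi.

Let stS n i : st n.+1 i = st n i + G (err (st n)) i. Proof. by []. Qed.

Let h n : R := 2^-1 ^+ n.
Let h_ge0 n : 0 <= h n. Proof. by rewrite exprn_ge0. Qed.
Let hS n : h n.+1 = h n / 2. Proof. by rewrite /h exprS mulrC. Qed.

Let st_inv n : (forall i, `|err (st n) i| <= del * h n) /\
  (forall i, `|st n i - xi i| <= 2 * K * del * (1 - h n)).
Proof.
elim: n => [|n [IHe IHd]].
  split=> i; first by rewrite /h expr0 mulr1; exact: xi_pseudo.
  by rewrite /h expr0 !subrr normr0 mulr0.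
set v := G (err (st n)).
have vb i : `|v i| <= K * (del * h n) by exact: G_bounded.
have Kdel : 0 <= K * del by exact: mulr_ge0.
have dist1 i : `|st n.+1 i - xi i| <= 2 * K * del * (1 - h n.+1).
  rewrite stS -/(v i) addrAC; apply: le_trans (ler_normD _ _) _.
  by have := IHd i; have := vb i; rewrite hS; nra.
split=> // i.
have r1 : `|st n.+1 i - xi i| < r.
  by apply: le_lt_trans (dist1 i) _; have := small_del; have := mulr_ge0 Kdel (h_ge0 n.+1); lra.
have r2 : `|st n i - xi i| < r.
  by apply: le_lt_trans (IHd i) _; have := small_del; have := mulr_ge0 Kdel (h_ge0 n); lra.
have e1 := phi_approx r1 r2.
have e2 : `|v (i + 1) - A i (v i) - err (st n) i| <= (del * h n) / 4.
  exact: G_inverse.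
have vi : st n.+1 i - st n i = v i by rewrite stS addrC addKr.
rewrite vi in e1.
have -> : err (st n.+1) i =
  (phi i (st n.+1 i) - phi i (st n i) - A i (v i)) - (v (i + 1) - A i (v i) - err (st n) i).
  rewrite [err (st n.+1) i]/err [err (st n) i]/err stS -/(v _).
  by apply/rowP => k; rewrite !mxE; ring.
apply: le_trans (ler_normB _ _) _.
have := vb i; rewrite hS => vbi.
have : theta * `|v i| <= theta * (K * (del * h n)) by apply: ler_wpM2l.
have dh : 0 <= del * h n by exact: mulr_ge0.
have : theta * (K * (del * h n)) <= 1 / 4 * (del * h n).
  by rewrite mulrA [theta * K]mulrC ler_wpM2r.
lra.
Qed.

Let Kd0 : 0 <= K * del. Proof. exact: mulr_ge0. Qed.

Let st_cauchy n k i : `|st (n + k) i - st n i| <= 2 * K * del * (h n - h (n + k)).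
Proof.
elim: k => [|k IH]; first by rewrite addn0 !subrr normr0 mulr0.
rewrite addnS hS stS addrAC; apply: le_trans (ler_normD _ _) _.
have [eb _] := st_inv (n + k).
have := G_bounded eb i; lra.
Qed.

Let st_cvg i : exists z, forall n, `|z - st n i| <= 2 * K * del * h n.
Proof.
have C : cauchy ((fun n => st n i) @ \oo).
  apply: cauchy_exP => e e0.
  have [N hN] : exists N : nat, forall n, (N <= n)%N -> 2 * K * del * 2^-1 ^+ n < e.
    by apply: geometric_small => //; lra.
  exists (st N i); exists N => // n /= Nn.
  rewrite -ball_normE /=.
  rewrite distrC -(subnKC Nn); apply: le_lt_trans (st_cauchy _ _ _) _.
  apply: le_lt_trans (hN N (leqnn N)); rewrite -/(h N).
  by have := mulr_ge0 Kd0 (h_ge0 (N + (n - N))); lra.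
have [z zl] : exists z : V, (fun k => st k i) @ \oo --> z.
  exact: (cvg_ex (T := V) _).1 (cauchy_cvg (T := V) _ C).
exists z => n.
apply/ler_addgt0Pr => e e0.
have /cvgrPdist_lt/(_ e e0)[N _ hN] := zl.
have := hN (n + N)%N (leq_addl _ _); have := st_cauchy n N i.
have := ler_normD (z - st (n + N) i) (st (n + N) i - st n i).
have := mulr_ge0 Kd0 (h_ge0 (n + N)).
rewrite addrA subrK /=; lra.
Qed.

(* Each Newton step spreads the influence of a jump by at most [T + 1]. *)
Let st_local n : (forall i : int,
  (forall j : int, (`|j - i| <= n * T.+1)%N -> phi j (xi j) = xi (j + 1)) ->
  st n i = xi i /\ err (st n) i = 0).
Proof.
elim: n => [|n IH] i hi.
  by split => //; rewrite /err /= hi ?subrr //; lia.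
have en (j : int) : (`|j - i| <= T.+1)%N -> st n j = xi j /\ err (st n) j = 0.
  by move=> ji; apply: IH => k kj; apply: hi; lia.
have v0 (j : int) : (`|j - i| <= 1)%N -> G (err (st n)) j = 0.
  by move=> ji; apply: G_local => k kj; apply: (en _ _).2; lia.
have [s0 e0] := en i ltac:(lia).
rewrite stS v0 ?addr0; last lia.
split => //; rewrite /err !stS !v0 ?addr0 //; lia.
Qed.

Lemma newton_shadowing : exists z, [/\ forall i, phi i (z i) = z (i + 1),
  forall i, `|z i - xi i| <= 2 * K * del &
  forall n (i : int), (forall j : int, (`|j - i| <= n * T.+1)%N -> phi j (xi j) = xi (j + 1)) ->
    `|z i - xi i| <= 2 * K * del * 2^-1 ^+ n].
Proof.
have [z hz] := choice st_cvg; exists z; split.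
- move=> i; apply/eqP; rewrite -subr_eq0 -normr_le0.
  have [L hL] := A_bounded i.
  apply: (@le_geometric_le0 _ _ ((theta + `|L| + 1) * (2 * K * del) + del)) => n.
  rewrite -/(h n).
  have zr : `|z i - xi i| < r.
    by apply: le_lt_trans (hz i 0%N) _; rewrite /h expr0 mulr1; exact: small_del.
  have sr : `|st n i - xi i| < r.
    by have [_ /(_ i)] := st_inv n; have := small_del; have := mulr_ge0 Kd0 (h_ge0 n); lra.
  have e1 := phi_approx zr sr.
  have [/(_ i) e2 _] := st_inv n.
  have -> : phi i (z i) - z (i + 1) = (phi i (z i) - phi i (st n i) - A i (z i - st n i))
     + A i (z i - st n i) + err (st n) i - (z (i + 1) - st n (i + 1)).
    by rewrite subrK /err addrA subrK opprB addrA subrK.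
  apply: le_trans (ler_normB _ _) _; have e3 := hz (i + 1) n.
  have := le_trans (ler_normD (phi i (z i) - phi i (st n i) - A i (z i - st n i)
     + A i (z i - st n i)) (err (st n) i)) (lerD (ler_normD _ _) (lexx _)).
  have e4 := hL (z i - st n i); have e5 := hz i n.
  have e6 : L * `|z i - st n i| <= `|L| * `|z i - st n i|.
    by apply: ler_wpM2r => //; exact: ler_norm.
  have e7 : `|L| * `|z i - st n i| <= `|L| * (2 * K * del * h n) by apply: ler_wpM2l.
  have e8 : theta * `|z i - st n i| <= theta * (2 * K * del * h n) by apply: ler_wpM2l.
  lra.
- by move=> i; have := hz i 0%N; rewrite /h expr0 mulr1.
- by move=> n i hi; have := hz i n; have [-> _] := st_local hi.
Qed.

End Newton.

(** * Hyperbolic sequences of linear maps *)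

Section LinearCocycle.
Context {R : realType} {V : normedModType R}.
Implicit Types (A : int -> {linear V -> V}) (Lam K mu : R).

Fixpoint cocycle (A : int -> {linear V -> V}) (n : nat) (i : int) (v : V) : V :=
  if n is n'.+1 then A (i + n'%:Z) (cocycle A n' i v) else v.

(** An approximate column of the inverse of [v |-> v (i + 1) - A i (v i)], for the
    right-hand side [e] at time [j].  The bounded window makes superpositions
    over all [j] finite sums. *)
Definition impulse_response (A : int -> {linear V -> V}) (T : nat) (C tau : R)
    (j : int) (e : V) (v : int -> V) := [/\
  forall i : int, (T < `|i - j|)%N -> v i = 0,
  forall i, `|v i| <= C * `|e| &
  forall i : int, `|v (i + 1) - A i (v i) - (if i == j then e else 0)| <= tau * `|e|].

(** [S i] and [U i] stand for the stable and unstable subspaces at time [i]; they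
    are predicates so that subspaces given in other coordinates can be pulled
    back. *)
Record hyperbolic_cocycle (A : int -> {linear V -> V}) (S U : int -> V -> Prop)
    (K mu Lam : R) : Prop := HyperbolicCocycle {
  cocycle_bounded : forall i v, `|A i v| <= Lam * `|v|;
  cocycle_split : forall i e, exists s u, [/\ S i s, U i u & e = s + u];
  cocycle_unstable : forall i u, U (i + 1) u -> exists2 w, U i w & A i w = u;
  cocycle_contract : forall n i s, (0 < n)%N -> S i s ->
    `|cocycle A n i s| <= K * mu ^+ n * `|s|;
  cocycle_expand : forall n i u, (0 < n)%N -> U i u ->
    `|u| <= K * mu ^+ n * `|cocycle A n i u| }.

Lemma cocycleD A n i u v : cocycle A n i (u + v) = cocycle A n i u + cocycle A n i v.
Proof. by elim: n => //= n ->; rewrite linearD. Qed.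

Lemma cocycleSl A n i v : cocycle A n.+1 i v = cocycle A n (i + 1) (A i v).
Proof.
elim: n => [|n IH]; first by rewrite /= addr0.
rewrite [LHS]/= -/(cocycle A n.+1 i v) IH /=; congr (A _ _); lia.
Qed.

Lemma cocycle_le A Lam n i v : 0 <= Lam -> (forall i v, `|A i v| <= Lam * `|v|) ->
  `|cocycle A n i v| <= Lam ^+ n * `|v|.
Proof.
move=> L0 h; elim: n => [|n IH]; first by rewrite expr0 mul1r.
by rewrite exprS -mulrA; apply: le_trans (h _ _) _; apply: ler_wpM2l.
Qed.

(** If [s + u] were much shorter than [s] and [u], then so would be its image
    under [N] steps, whose length is at most [Lam ^+ N] times larger, although [u]
    has been expanded and [s] contracted by then.  The bound therefore depends on
    the hyperbolicity constants only. *)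
Lemma splitting_angle (K mu Lam : R) : 0 < mu < 1 -> 0 < K -> 0 <= Lam ->
  exists2 P, 0 < P & forall A S U, hyperbolic_cocycle A S U K mu Lam ->
  forall i s u, S i s -> U i u -> `|s| <= P * `|s + u| /\ `|u| <= P * `|s + u|.
Proof.
move=> /andP[mu0 mu1] K0 L0.
have [N hN] : exists N : nat, forall n, (N <= n)%N -> K * mu ^+ n < 1 / 2.
  by apply: geometric_small; lra.
have N0 : (0 < N.+1)%N by [].
have LN : 0 <= Lam ^+ N.+1 by exact: exprn_ge0.
exists (Lam ^+ N.+1 + 2); first lra.
move=> A S U hA i s u Ss Uu.
have hs := cocycle_contract hA N0 Ss; have hu := cocycle_expand hA N0 Uu.
have he := cocycle_le N.+1 i (s + u) L0 (cocycle_bounded hA).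
have KN := hN N.+1 (leqnSn N).
have KN0 : 0 <= K * mu ^+ N.+1 by rewrite mulr_ge0 ?exprn_ge0; lra.
have e1 : `|cocycle A N.+1 i u| <= `|cocycle A N.+1 i (s + u)| + `|cocycle A N.+1 i s|.
  by rewrite cocycleD -[X in `|X| <= _](addKr (cocycle A N.+1 i s)) addrC; apply: ler_normB.
have e2 : `|s| <= `|s + u| + `|u|.
  by rewrite -[X in `|X| <= _](addrK u s); apply: ler_normB.
have s0 := normr_ge0 s; have u0 := normr_ge0 u; have su0 := normr_ge0 (s + u).
set q := K * mu ^+ N.+1 in hs hu KN KN0.
have e3 : q * `|s| <= 1 / 2 * `|s| by exact: ler_wpM2r (ltW KN).
have e4 : q * `|cocycle A N.+1 i u| <= 1 / 2 * `|cocycle A N.+1 i u| by exact: ler_wpM2r (ltW KN).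
split; lra.
Qed.

(** Backward orbits inside the unstable spaces exist by surjectivity on them, and
    decay because their forward iterates expand. *)
Lemma unstable_backward_orbit A S U K mu Lam j u :
  hyperbolic_cocycle A S U K mu Lam -> U (j + 1) u ->
  exists w : nat -> V, [/\ w 0%N = u, forall n, A (j - n%:Z) (w n.+1) = w n &
    forall n, `|w n.+1| <= K * mu ^+ n.+1 * `|u|].
Proof.
move=> hA Uu.
have [g hg] : exists g : int * V -> V, forall p, U (p.1 + 1) p.2 ->
    U p.1 (g p) /\ A p.1 (g p) = p.2.
  suff /choice[g hg] : forall p : int * V, exists w,
      U (p.1 + 1) p.2 -> U p.1 w /\ A p.1 w = p.2 by exists g.
  move=> -[i x] /=.
  have [/(cocycle_unstable hA)[w Uw Aw]|nU] := pselect (U (i + 1) x); first by exists w.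
  by exists 0.
pose w := fix w n := if n is n'.+1 then g (j - n'%:Z, w n') else u.
have idx (k : nat) : j + 1 - k.+1%:Z = j - k%:Z /\ j - k%:Z + 1 = j + 1 - k%:Z.
  by clear; lia.
have wS k : U (j + 1 - k%:Z) (w k) -> U (j - k%:Z) (w k.+1) /\ A (j - k%:Z) (w k.+1) = w k.
  by move=> Uk; apply: (hg (j - k%:Z, w k)); rewrite /= (idx k).2.
have wU n : U (j + 1 - n%:Z) (w n).
  elim: n => [|n IH]; first by rewrite subr0.
  by rewrite (idx n).1; case: (wS n IH).
have wA n : A (j - n%:Z) (w n.+1) = w n by case: (wS n (wU n)).
have wc n : cocycle A n (j + 1 - n%:Z) (w n) = u.
  by elim: n => [//|n IH]; rewrite cocycleSl -[RHS]IH (idx n).1 (idx n).2 wA.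
exists w; split => // n.
by have := cocycle_expand hA (ltn0Sn n) (wU n.+1); rewrite wc.
Qed.

Lemma two_sided_sequence (p q : nat -> V) (T : nat) (j : int) :
  exists v : int -> V, [/\ forall i : int, (T < `|i - j|)%N -> v i = 0,
    forall k : nat, (k < T)%N -> v (j + 1 + k%:Z) = p k &
    forall k : nat, (k <= T)%N -> v (j - k%:Z) = q k].
Proof.
exists (fun i => if (T < `|i - j|)%N then 0 else
  if j < i then p `|i - j|%N.-1 else q `|i - j|%N); split => [i ->|k kT|k kT] //.
- rewrite ifF; last by clear -kT; lia.
  rewrite ifT; last by clear; lia.
  by congr p; clear; lia.
- rewrite ifF; last by clear -kT; lia.
  rewrite ifF; last by clear; lia.
  by congr q; clear; lia.
Qed.

Lemma window_cases (T : nat) (j i : int) :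
  [\/ (T < `|i - j|)%N, exists2 k : nat, (k < T)%N & i = j + 1 + k%:Z |
    exists2 k : nat, (k <= T)%N & i = j - k%:Z].
Proof.
have [ij|ij] := leqP `|i - j|%N T; last exact: Or31.
have [ji|ji] := ltP j i; [apply: Or32|apply: Or33].
  by exists `|i - j|%N.-1; lia.
by exists `|i - j|%N; lia.
Qed.

(** The exact response is the forward orbit of the stable part of [e] at times
    after [j], and minus the backward orbit of its unstable part inside the
    unstable spaces up to time [j].  Cutting it off at distance [T] creates the
    errors, one at each end of the window. *)
Lemma hyperbolic_impulse A S U K mu Lam P T j e :
  0 < mu < 1 -> 1 <= K -> 0 < P -> (0 < T)%N -> hyperbolic_cocycle A S U K mu Lam ->
  (forall i s u, S i s -> U i u -> `|s| <= P * `|s + u| /\ `|u| <= P * `|s + u|) ->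
  exists v, impulse_response A T (K * P) (K * P * mu ^+ T) j e v.
Proof.
move=> /andP[mu0 mu1] K1 P0 T0 hA angle.
have [s [u [Ss Uu eE]]] := cocycle_split hA (j + 1) e.
have [sP uP] := angle _ _ _ Ss Uu; rewrite -eE in sP uP.
have [w [w0 wA wb]] := unstable_backward_orbit hA Uu.
pose p k := cocycle A k (j + 1) s.
have [v [v0 vp vw]] := two_sided_sequence p (fun k => - w k.+1) T j.
have K0 : 0 <= K by lra.
have mu_ge0 n : 0 <= mu ^+ n by rewrite exprn_ge0 // ltW.
have Pe : 0 <= P * `|e| by rewrite mulr_ge0 // ltW.
have decay n (x : V) : `|x| <= P * `|e| -> K * mu ^+ n * `|x| <= K * P * mu ^+ n * `|e|.
  move=> xP; have -> : K * P * mu ^+ n * `|e| = K * mu ^+ n * (P * `|e|) by ring.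
  by apply: ler_wpM2l => //; exact: mulr_ge0.
have antitone n : (T <= n)%N -> K * P * mu ^+ n * `|e| <= K * P * mu ^+ T * `|e|.
  move=> Tn; apply: ler_wpM2r => //; apply: ler_wpM2l; first by rewrite mulr_ge0 // ltW.
  by apply: ler_wiXn2l => //; exact: ltW.
have le1 n : K * P * mu ^+ n * `|e| <= K * P * `|e|.
  rewrite mulrAC ler_piMr //; first by rewrite -mulrA mulr_ge0.
  by rewrite exprn_ile1 // ltW.
have rhs0 : 0 <= K * P * mu ^+ T * `|e|.
  by rewrite mulr_ge0 // mulr_ge0 // mulr_ge0 // ltW.
have pb k : `|p k.+1| <= K * P * mu ^+ k.+1 * `|e|.
  by apply: le_trans (cocycle_contract hA (ltn0Sn _) Ss) _; exact: decay.
have qb k : `|w k.+1| <= K * P * mu ^+ k.+1 * `|e|.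
  by apply: le_trans (wb k) _; exact: decay.
have pS k : A (j + 1 + k%:Z) (p k) = p k.+1 by [].
exists v; split.
- exact: v0.
- move=> i; case: (window_cases T j i) => [iT|[k kT ->]|[k kT ->]].
  + by rewrite v0 // normr0 -mulrA mulr_ge0.
  + rewrite vp //; case: k kT => [_|k _]; last exact: le_trans (pb k) (le1 _).
    by apply: le_trans sP _; rewrite -mulrA ler_peMl.
  + by rewrite vw // normrN; exact: le_trans (qb k) (le1 _).
- move=> i; case: (window_cases T j i) => [iT|[k kT iE]|[k kT iE]].
  + rewrite [v i]v0 // linear0 subr0 ifF ?subr0; last by clear -iT; lia.
    have [iT1|iT1] := ltnP T `|(i + 1 - j)%R|%N; first by rewrite v0 // normr0.
    have -> : i + 1 = j - T%:Z by clear -iT iT1; lia.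
    by rewrite vw // normrN; apply: le_trans (qb T) (antitone _ _).
  + rewrite ifF; last by clear -iE; lia.
    have -> : i + 1 = j + 1 + k.+1%:Z by clear -iE; lia.
    rewrite iE (vp k kT) pS subr0.
    have [kT1|kT1] := ltnP k.+1 T; first by rewrite vp // subrr normr0.
    rewrite v0 ?sub0r ?normrN; last by clear -kT1; lia.
    by apply: le_trans (pb k) (antitone _ _).
  + case: k kT iE => [_|k kT] iE.
      have -> : i = j by rewrite iE subr0.
      have vj : v j = - w 1%N by have := vw 0%N (leq0n T); rewrite subr0.
      have vj1 : v (j + 1) = s by have := vp 0%N T0; rewrite addr0.
      have := wA 0%N; rewrite subr0 w0 => Aw.
      by rewrite eqxx vj vj1 linearN opprK Aw -eE subrr normr0.
    rewrite ifF ?subr0; last by clear -iE; lia.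
    have -> : i + 1 = j - k%:Z by clear -iE; lia.
    by rewrite iE (vw _ kT) (vw _ (ltnW kT)) linearN opprK wA addNr normr0.
Qed.

Lemma impulse_perturb (A B : int -> {linear V -> V}) T C tau eta j e v :
  0 <= eta -> (forall (i : int) x, (`|i - j| <= T)%N -> `|B i x - A i x| <= eta * `|x|) ->
  impulse_response A T C tau j e v ->
  impulse_response B T C (tau + eta * C) j e v.
Proof.
move=> eta0 AB [v0 vb ve]; split => // i.
have [ij|ij] := leqP `|i - j|%N T; last first.
  have := ve i; have := vb i; rewrite v0 // !linear0 normr0.
  have := ler_wpM2l eta0 (vb i); rewrite v0 // normr0 mulr0.
  lra.
have -> : v (i + 1) - B i (v i) - (if i == j then e else 0) =
  v (i + 1) - A i (v i) - (if i == j then e else 0) - (B i (v i) - A i (v i)).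
  by rewrite opprB addrA [_ - _ + A _ _]addrAC subrK addrAC.
apply: le_trans (ler_normB _ _) _.
have := ve i; have := AB i (v i) ij; have := ler_wpM2l eta0 (vb i); lra.
Qed.

(** Superposition: at most [2 * T + 2] impulse responses, or their truncation
    errors, are nonzero at a given time, so the sums are finite and the errors
    add up to a fixed multiple of [tau]. *)
Lemma assemble_impulses (A : int -> {linear V -> V}) T C tau : 0 <= C -> 0 <= tau ->
  (forall j e, exists v, impulse_response A T C tau j e v) ->
  exists G : (int -> V) -> int -> V, [/\
    forall e eta, (forall i, `|e i| <= eta) -> forall i, `|G e i| <= (2 * T + 1)%:R * C * eta,
    forall e eta, (forall i, `|e i| <= eta) ->
      forall i, `|G e (i + 1) - A i (G e i) - e i| <= (2 * T + 2)%:R * (tau * eta) &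
    forall e (i : int), (forall j : int, (`|j - i| <= T)%N -> e j = 0) -> G e i = 0].
Proof.
move=> C0 tau0 h.
have [F hF] : exists F : int * V -> int -> V, forall p, impulse_response A T C tau p.1 p.2 (F p).
  suff /choice[F hF] : forall p : int * V, exists v, impulse_response A T C tau p.1 p.2 v by exists F.
  by move=> -[j e]; exact: h.
pose term (e : int -> V) (j i : int) := F (j, e j) i.
have term0 e (j i : int) : (T < `|i - j|)%N -> term e j i = 0.
  by move=> ij; have [+ _ _] := hF (j, e j); apply.
pose G e i := \sum_(k < 2 * T + 1) term e (i - T%:Z + k%:Z) i.
have normsum n (g : 'I_n -> V) B : (forall k, `|g k| <= B) -> `|\sum_k g k| <= n%:R * B.
  move=> gB; apply: le_trans (ler_norm_sum _ _ _) _.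
  apply: le_trans (ler_sum _ (fun k _ => gB k)) _.
  by rewrite sumr_const card_ord mulr_natl.
exists G; split.
- move=> e eta eb i; rewrite -mulrA; apply: normsum => k.
  have [_ + _] := hF (i - T%:Z + k%:Z, e (i - T%:Z + k%:Z)).
  by move=> /(_ i) /le_trans; apply; apply: ler_wpM2l => //; exact: eb.
- move=> e eta eb i.
  (* The windows around [i] and [i + 1] differ; both sums are extended by zero
     terms to their union. *)
  have -> : G e i = \sum_(k < (2 * T + 1).+1) term e (i - T%:Z + k%:Z) i.
    by rewrite big_ord_recr /= [term _ _ _]term0 ?addr0 //; lia.
  have -> : G e (i + 1) = \sum_(k < (2 * T + 1).+1) term e (i - T%:Z + k%:Z) (i + 1).
    rewrite big_ord_recl /= term0 ?add0r; last lia.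
    by apply: eq_bigr => k _; congr term; rewrite /bump /=; lia.
  have eE : e i = \sum_(k < (2 * T + 1).+1)
      (if i == i - T%:Z + k%:Z then e (i - T%:Z + k%:Z) else 0).
    have Tlt : (T < (2 * T + 1).+1)%N by lia.
    rewrite (bigD1 (Ordinal Tlt)) //= big1 ?addr0 => [|k kT].
      by rewrite subrK eqxx.
    rewrite ifF //; apply: contraNF kT => /eqP ik; apply/eqP/val_inj => /=; lia.
  rewrite [in X in _ - X]eE linear_sum -!sumrB.
  have -> : (2 * T + 2)%N = (2 * T + 1).+1 by lia.
  apply: normsum => k.
  have [_ _ /(_ i)] := hF (i - T%:Z + k%:Z, e (i - T%:Z + k%:Z)).
  by move=> /le_trans; apply; apply: ler_wpM2l => //; exact: eb.
- move=> e i e0; rewrite /G big1 // => k _; rewrite /term e0; last first.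
    by have := ltn_ord k; lia.
  apply/eqP; rewrite -normr_le0.
  by have [_ /(_ i) + _] := hF (i - T%:Z + k%:Z, 0); rewrite /= normr0 mulr0.
Qed.

End LinearCocycle.

(** * Differential calculus in normed spaces *)

Section Calculus.
Context {R : realType}.

(** Maps read in charts agree with compositions of such maps only near a point. *)
Lemma near_eq_diff (V W : normedModType R) (f g : V -> W) x :
  (\forall y \near x, f y = g y) -> differentiable f x ->
  differentiable g x /\ 'd g x = 'd f x :> (V -> W).
Proof.
move=> fg df; have fgx : f x = g x := nbhs_singleton fg.
have [cdf ef] := (diff_locallyP _ _).1 df.
have eg : g \o shift x = cst (g x) + 'd f x +o_ 0 id.
  apply/eqaddoP => e e0; move/eqaddoP/(_ e e0) : ef.
  have : \forall h \near (0 : V), f (h + x) = g (h + x).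
    by move: fg; rewrite (near_shift (0 : V)) /= subr0.
  apply: filter_app2; near=> h => /= fgh.
  by rewrite !fctE /= -fgx -fgh.
have dg := diff_unique cdf eg.
split; last exact: dg.
by apply/diff_locallyP; rewrite dg; split; [exact: cdf|exact: eg].
Unshelve. all: by end_near. Qed.

Lemma coord_le_norm m (v : 'rV[R]_m) k : `|v 0 k| <= `|v|.
Proof.
rewrite [leRHS]/Num.norm /= mx_normrE; apply/bigmax_geP; right => /=.
by exists (0, k).
Qed.

Lemma norm_le_coord m (v : 'rV[R]_m) B : 0 <= B -> (forall k, `|v 0 k| <= B) -> `|v| <= B.
Proof.
move=> B0 h; rewrite [leLHS]/Num.norm /= mx_normrE; apply/bigmax_leP; split => //.
by move=> [i k] _ /=; rewrite (ord1 i).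
Qed.

Lemma linear_row_leB m (W : normedModType R) (L1 L2 : {linear 'rV[R]_m -> W}) v :
  `|L1 v - L2 v| <= (\sum_k `|L1 (delta_mx 0 k) - L2 (delta_mx 0 k)|) * `|v|.
Proof.
have E (L : {linear 'rV[R]_m -> W}) : L v = \sum_k v 0 k *: L (delta_mx 0 k).
  rewrite {1}(row_sum_delta v) linear_sum; apply: eq_bigr => k _; exact: linearZ.
rewrite (E L1) (E L2) -sumrB.
apply: le_trans (ler_norm_sum _ _ _) _; rewrite mulr_suml; apply: ler_sum => k _.
rewrite -scalerBr normrZ mulrC.
by apply: ler_wpM2l => //; exact: coord_le_norm.
Qed.

Lemma diff_cont_uniform m (W : normedModType R) (f : 'rV[R]_m -> W) x :
  (forall v, {for x, continuous (fun y => 'd f y v)}) ->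
  forall e, 0 < e -> \forall y \near x, forall v, `|'d f y v - 'd f x v| <= e * `|v|.
Proof.
move=> h e e0.
have e10 : 0 < e / m.+1%:R by rewrite divr_gt0.
have : \forall y \near x, forall k : 'I_m, `|'d f y (delta_mx 0 k) - 'd f x (delta_mx 0 k)| <= e / m.+1%:R.
  apply: (filter_forall (f := fun k y => `|'d f y (delta_mx 0 k) - 'd f x (delta_mx 0 k)| <= e / m.+1%:R) (F := nbhs x)) => k.
  have /cvgrPdist_le/(_ _ e10) := h (delta_mx 0 k).
  by apply: filterS => y /= hy; rewrite distrC; exact: hy.
apply: filterS => y hy v.
apply: le_trans (linear_row_leB _ _ v) _; apply: ler_wpM2r => //.
apply: le_trans (ler_sum _ (fun k _ => hy k)) _.
rewrite sumr_const card_ord -[X in X <= _]mulr_natr -mulrA ler_piMr ?(ltW e0) //.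
by rewrite mulrC ler_pdivrMr // mul1r ler_nat.
Qed.

(** The mean value theorem applied to each coordinate along the segment from [y]
    to [x]; the norm on row vectors is the maximum of the coordinates. *)
Lemma mean_value_approx m n (f : 'rV[R]_m -> 'rV[R]_n) x0 r theta : 0 <= theta ->
  (forall y, `|y - x0| < r -> differentiable f y) ->
  (forall y, `|y - x0| < r -> forall v, `|'d f y v - 'd f x0 v| <= theta * `|v|) ->
  forall x y, `|x - x0| < r -> `|y - x0| < r ->
    `|f x - f y - 'd f x0 (x - y)| <= theta * `|x - y|.
Proof.
move=> th0 dif h x y xr yr.
apply: norm_le_coord => [|k]; first by rewrite mulr_ge0.
have inball (t : R) : 0 <= t <= 1 -> `|t *: (x - y) + y - x0| < r.
  move=> /andP[t0 t1].
  have -> : t *: (x - y) + y - x0 = t *: (x - x0) + (1 - t) *: (y - x0).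
    by apply/rowP => j; rewrite !mxE; ring.
  apply: le_lt_trans (ler_normD _ _) _; rewrite !normrZ (ger0_norm t0).
  rewrite (@ger0_norm _ (1 - t)) ?subr_ge0 //.
  have s0 : 0 <= 1 - t by rewrite subr_ge0.
  move: (`|x - x0|) (`|y - x0|) xr yr => a b ar br.
  have [ab|/ltW ba] := leP a b.
    by have := ler_wpM2l t0 ab; lra.
  by have := ler_wpM2l s0 ba; lra.
pose l (t : R) : 'rV[R]_m := t *: (x - y) + y.
pose g (t : R) : R := f (l t) 0 k.
have dl t : differentiable l t /\ forall s, 'd l t s = s *: (x - y).
  have H : is_diff t l ( *:%R ^~ (x - y) + 0) by apply: is_diffD.
  split; first exact: ex_diff.
  by move=> s; rewrite diff_val !fctE addr0.
have dg (t : R) : 0 <= t <= 1 -> is_derive t 1 g ('d f (l t) (x - y) 0 k).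
  move=> t01; have [dl1 dl2] := dl t.
  have dfl : differentiable f (l t) by apply: dif; exact: inball.
  have dfl2 : differentiable (f \o l) t by apply: differentiable_comp.
  have derfl : derivable (f \o l) t 1 by exact: diff_derivable.
  apply: DeriveDef; first by have /derivable_mxP/(_ 0 k) := derfl.
  have -> : 'D_1 g t = ('D_1 (f \o l) t) 0 k by rewrite derive_mx // mxE.
  by rewrite deriveE // diff_comp //= dl2 scale1r.
have cg : {within `[0, 1], continuous g}.
  apply: continuous_in_subspaceT => t /set_mem; rewrite /= in_itv /= => t01.
  apply/differentiable_continuous/derivable1_diffP.
  by have [] := dg t t01.
have [c c01] := @MVT R g _ 0 1 ltr01 (fun t t01 => dg t (subset_itv_oo_cc t01)) cg.
have cc01 : 0 <= c <= 1 by move: c01; rewrite in_itv /= => /andP[/ltW -> /ltW ->].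
rewrite subr0 mulr1 => gE.
have g1 : g 1 = f x 0 k by rewrite /g /l scale1r subrK.
have g0 : g 0 = f y 0 k by rewrite /g /l scale0r add0r.
have E : (f x - f y - 'd f x0 (x - y)) 0 k = ('d f (l c) (x - y) - 'd f x0 (x - y)) 0 k.
  rewrite [LHS]mxE [X in X + _]mxE [(- f y) 0 k]mxE -g1 -g0 gE.
  by rewrite [RHS]mxE.
rewrite E; apply: le_trans (coord_le_norm _ k) _.
exact: h _ (inball c cc01) (x - y).
Qed.

End Calculus.

(** * Maps read in charts *)

Section Charts.
Context {R : realType} {m : nat} {M : topologicalType}.
Implicit Types c d e : chart R m M.

(** With [F = id] this is a change of charts, so that the chain rule for maps
    below also covers changes of coordinates. *)
Definition in_charts c d (F : M -> M) : 'rV[R]_m -> 'rV[R]_m := d \o F \o chart_inv c.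

Lemma near_chart_inv c x (U : set M) : chart_dom c x -> nbhs x U ->
  \forall y \near c x, U (chart_inv c y).
Proof.
move=> cx nU; apply: (chart_inv_continuous (chart_map_img cx)).
by rewrite chart_mapK.
Qed.

Lemma near_chart_img c x : chart_dom c x -> \forall y \near c x, chart_img c y.
Proof.
by move=> cx; apply: open_nbhs_nbhs; split; [exact: chart_img_open|exact: chart_map_img].
Qed.

Lemma near_chart_dom c x : chart_dom c x -> \forall y \near x, chart_dom c y.
Proof. by move=> cx; apply: open_nbhs_nbhs; split => //; exact: chart_dom_open. Qed.

Lemma in_charts_comp c d e (F G : M -> M) x :
  chart_dom c x -> chart_dom d (F x) -> {for x, continuous F} ->
  differentiable (in_charts c d F) (c x) ->
  differentiable (in_charts d e G) (d (F x)) ->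
  differentiable (in_charts c e (G \o F)) (c x) /\
  forall v, 'd (in_charts c e (G \o F)) (c x) v =
    'd (in_charts d e G) (d (F x)) ('d (in_charts c d F) (c x) v).
Proof.
move=> cx dFx Fc dF dG.
have dG' : differentiable (in_charts d e G) (in_charts c d F (c x)).
  by rewrite /in_charts /= chart_mapK.
have nE : \forall y \near c x,
    (in_charts d e G \o in_charts c d F) y = in_charts c e (G \o F) y.
  have : \forall y \near c x, chart_dom d (F (chart_inv c y)).
    apply: (@near_chart_inv c x (F @^-1` chart_dom d) cx).
    by apply: Fc; exact: near_chart_dom.
  by apply: filterS => y dy; rewrite /in_charts /= chart_mapK.
have [h1 h2] := near_eq_diff nE (differentiable_comp dF dG').
split; first exact: h1.
have eFx : in_charts c d F (c x) = d (F x) by rewrite /in_charts /= chart_mapK.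
move=> v.
have h3 := congr1 (fun h : 'rV[R]_m -> 'rV[R]_m => h v) h2.
have h4 := congr1 (fun h : 'rV[R]_m -> 'rV[R]_m => h v) (diff_comp dF dG').
rewrite /= eFx in h4.
exact: (etrans h3 h4).
Qed.

Lemma in_charts_id c x : chart_dom c x ->
  forall v, 'd (in_charts c c id) (c x) v = v.
Proof.
move=> cx.
have nE : \forall y \near c x, (@idfun 'rV[R]_m) y = in_charts c c id y.
  by apply: filterS (near_chart_img cx) => y iy; rewrite /in_charts /= chart_invK.
have cid : continuous (@idfun 'rV[R]_m) by move=> y.
have [_ h] := near_eq_diff nE (linear_differentiable (f := idfun) (c x) cid).
move=> v.
have h1 := congr1 (fun h : 'rV[R]_m -> 'rV[R]_m => h v) h.
have h2 := congr1 (fun h : 'rV[R]_m -> 'rV[R]_m => h v) (diff_lin (f := idfun) (c x) cid).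
exact: (etrans h1 h2).
Qed.

Variable X : smooth_manifold R m M.

Lemma transition_differentiable c d x : atlas X c -> atlas X d ->
  chart_dom c x -> chart_dom d x -> differentiable (in_charts c d id) (c x).
Proof.
move=> ac ad cx dx; have [h _] := atlas_smooth ac ad 1%N.
by apply: h; split; [exact: chart_map_img|rewrite /= chart_mapK].
Qed.

Lemma C1_differentiable f c d x : C1_on X setT f -> atlas X c -> atlas X d ->
  chart_dom c x -> chart_dom d (f x) -> differentiable (in_charts c d f) (c x).
Proof.
move=> [_ fC1] ac ad cx dx; have [h _] := fC1 _ _ ac ad.
by apply: h; split => //; [exact: chart_map_img|rewrite /= chart_mapK].
Qed.

Lemma C1_diff_continuous f c d x : C1_on X setT f -> atlas X c -> atlas X d ->
  chart_dom c x -> chart_dom d (f x) ->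
  forall v, {for c x, continuous (fun y => 'd (in_charts c d f) y v)}.
Proof.
move=> [_ fC1] ac ad cx dx v; have [_ h] := fC1 _ _ ac ad.
by apply: (h v); split => //; [exact: chart_map_img|rewrite /= chart_mapK].
Qed.

(** Change of components, from [c] to the chart that represents the tangent space
    at [x]. *)
Definition to_tangent c x : {linear 'rV[R]_m -> 'rV[R]_m} :=
  'd (in_charts c (chart_at X x) id) (c x).

Lemma to_tangent_bij c x : atlas X c -> chart_dom c x ->
  exists T : 'rV[R]_m -> 'rV[R]_m, cancel T (to_tangent c x) /\ cancel (to_tangent c x) T.
Proof.
move=> ac cx; set a := chart_at X x.
have aa : atlas X a by exact: chart_at_atlas.
have ax : chart_dom a x by exact: chart_at_dom.
have ci : {for x, continuous (id : M -> M)} by [].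
have d1 := transition_differentiable ac aa cx ax.
have d2 := transition_differentiable aa ac ax cx.
exists ('d (in_charts a c id) (a x)); split => v; rewrite /to_tangent -/a.
  by have [_ <-] := in_charts_comp (F := id) (G := id) ax cx ci d2 d1; exact: in_charts_id.
by have [_ <-] := in_charts_comp (F := id) (G := id) cx ax ci d1 d2; exact: in_charts_id.
Qed.

Lemma tangent_map_in_charts f c d x v : C1_on X setT f -> atlas X c -> atlas X d ->
  chart_dom c x -> chart_dom d (f x) ->
  to_tangent d (f x) ('d (in_charts c d f) (c x) v) = tangent_map X f x (to_tangent c x v).
Proof.
move=> fC1 ac ad cx dfx.
set a := chart_at X x; set b := chart_at X (f x).
have aa : atlas X a by exact: chart_at_atlas.
have ax : chart_dom a x by exact: chart_at_dom.
have ab : atlas X b by exact: chart_at_atlas.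
have bx : chart_dom b (f x) by exact: chart_at_dom.
have ci : {for x, continuous (id : M -> M)} by [].
have cf : {for x, continuous f} by exact: fC1.1.
have [_ e1] := in_charts_comp (F := f) (G := id) cx dfx cf
  (C1_differentiable fC1 ac ad cx dfx) (transition_differentiable ad ab dfx bx).
have [_ e2] := in_charts_comp (F := id) (G := f) cx ax ci
  (transition_differentiable ac aa cx ax) (C1_differentiable fC1 aa ab ax bx).
have E1 : id \o f = f by [].
have E2 : f \o id = f by [].
rewrite E1 in e1; rewrite E2 in e2.
transitivity ('d (in_charts c b f) (c x) v); first by symmetry; exact: e1.
exact: e2.
Qed.

Lemma tangent_mapD f n x v : C1_on X setT f ->
  differentiable (in_charts (chart_at X x) (chart_at X (iter n f x)) (iter n f))
    (chart_at X x x) /\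
  tangent_map X (iter n.+1 f) x v =
    tangent_map X f (iter n f x) (tangent_map X (iter n f) x v).
Proof.
move=> fC1.
have aa y : atlas X (chart_at X y) by exact: chart_at_atlas.
have ay y : chart_dom (chart_at X y) y by exact: chart_at_dom.
have cf k : {for x, continuous (iter k f)}.
  elim: k => [|k IH]; first by [].
  by apply: continuous_comp => //; apply: fC1.1.
have dn k : differentiable (in_charts (chart_at X x) (chart_at X (iter k f x)) (iter k f))
    (chart_at X x x).
  elim: k => [|k IH]; first exact: transition_differentiable.
  have [h _] := in_charts_comp (F := iter k f) (G := f) (ay _) (ay _) (cf k) IH
    (C1_differentiable fC1 (aa _) (aa _) (ay (iter k f x)) (ay _)).
  exact: h.
split; first exact: dn.
have [_ h] := in_charts_comp (F := iter n f) (G := f) (ay _) (ay _) (cf n) (dn n)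
    (C1_differentiable fC1 (aa _) (aa _) (ay (iter n f x)) (ay _)).
exact: h.
Qed.

End Charts.

(** * Compactness and finite atlases *)

Section Uniform.
Context {R : realType}.

(** Local-to-global principle behind all uniform constants below. *)
Lemma compact_uniform (M : topologicalType) (K : set M) (P : R -> M -> Prop) :
  compact K -> (forall r r' x, r' <= r -> P r x -> P r' x) ->
  (forall x, K x -> exists2 r, 0 < r & \forall y \near x, K y -> P r y) ->
  exists2 r, 0 < r & forall x, K x -> P r x.
Proof.
move=> /compact_near_coveringP/near_covering_withinP cK mono loc.
have H := cK R (0^'+) P _ _.
have [] : \forall r \near 0^'+, K `<=` P r.
  apply: H => x /loc[r r0 hr].
  exists ([set y | K y -> P r y], [set s | s < r]); first split => //=.
    exact: nbhs_right_lt.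
  by move=> [y s] /= [yP sr] Ky; apply: (mono r); [exact: ltW|exact: yP].
move=> e /= e0 he; exists (e / 2); first by rewrite divr_gt0.
apply: he; last by rewrite divr_gt0.
by rewrite /= sub0r normrN gtr0_norm ?divr_gt0 // ltr_pdivrMr // ltr_pMr // ltr1n.
Qed.

Lemma fset_uniform (T : choiceType) (D : {fset T}) (P : R -> T -> Prop) :
  (forall r r' x, r' <= r -> P r x -> P r' x) ->
  (forall x, x \in D -> exists2 r, 0 < r & P r x) ->
  exists2 r, 0 < r & forall x, x \in D -> P r x.
Proof.
move=> mono loc.
have H : \forall r \near 0^'+, forall x, x \in D -> P r x.
  have : (0^'+) (\bigcap_(x in [set` D]) [set r : R | P r x]).
    apply: filter_bigI => x /loc[r r0 Pr].
    by apply: filterS (nbhs_right_lt r0) => s sr; apply: mono Pr; exact: ltW.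
  by apply: filterS => r h x xD; exact: (h x xD).
have [r [hr r0]] := @filter_ex _ (0^'+) _ _ (filterI H (nbhs_right_gt (0 : R))).
by exists r.
Qed.

End Uniform.

Section SeparatingMetric.
Context {R : realType} {M : topologicalType}.
Variable d : M -> M -> R.

(** On a compact space a continuous distance that separates points induces the
    topology: away from a neighbourhood of [x] the distance to [x] is bounded
    below. *)
Lemma continuous_separating_metric : compact [set: M] ->
  (forall x, d x x = 0) -> (forall x y, d x y = d y x) ->
  (forall x y z, d x z <= d x y + d y z) ->
  (forall x e, 0 < e -> \forall y \near x, d x y < e) ->
  (forall x y, d x y = 0 -> x = y) -> compatible_metric d.
Proof.
move=> cM d0 ds dt dc dsep.
have dge0 x y : 0 <= d x y by have := dt x y x; rewrite d0 (ds y x); lra.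
split => // x U; split; last first.
  by move=> [e e0 h]; apply: filterS (dc x e e0) => y; exact: h.
move=> nU; have cK : compact (~` U°).
  by apply: (subclosed_compact _ cM) => //; apply: open_closedC; exact: open_interior.
have [r r0 hr] : exists2 r : R, 0 < r & forall y, (~` U°) y -> r <= d x y.
  apply: (compact_uniform (P := fun r y => r <= d x y) cK).
    by move=> r r' y rr'; apply: le_trans.
  move=> y nUy; have dy : 0 < d x y.
    rewrite lt_neqAle dge0 andbT eq_sym; apply/eqP => /dsep exy.
    by apply: nUy; rewrite -exy.
  exists (d x y / 2); first by rewrite divr_gt0.
  have : \forall z \near y, d y z < d x y / 2 by apply: dc; rewrite divr_gt0.
  by apply: filterS => z yz _; have := dt x z y; rewrite (ds z y); lra.
exists r => // y xy; apply: contrapT => nUy.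
have /hr : (~` U°) y by move=> /interior_subset.
by rewrite leNgt xy.
Qed.

End SeparatingMetric.

Section FiniteAtlas.
Context {R : realType} {m : nat} {M : topologicalType}.
Variable X : smooth_manifold R m M.
Hypothesis M_compact : compact [set: M].
Local Notation ch p := (chart_at X p).

(** The factor 2 leaves room around the balls of radius [rho p] that cover [M]:
    points close to such a ball, such as points of nearby orbits, stay in the
    chart. *)
Lemma chart_radius : exists rho : M -> R, forall p, 0 < rho p /\
  forall y, `|y - ch p p| <= 2 * rho p -> chart_img (ch p) y.
Proof.
suff /choice[rho h] : forall p, exists r, 0 < r /\
    forall y, `|y - ch p p| <= 2 * r -> chart_img (ch p) y by exists rho.
move=> p; have := near_chart_img (chart_at_dom X p).
move/nbhs_ballP => [e /= e0 he]; exists (e / 3); split; first lra.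
by move=> y hy; apply: he; rewrite -ball_normE /= distrC; lra.
Qed.

Definition core (rho : M -> R) (s : R) (p : M) : set M :=
  [set x | chart_dom (ch p) x /\ `|ch p x - ch p p| <= s * rho p].

Variable rho : M -> R.
Hypothesis rho_gt0 : forall p, 0 < rho p.
Hypothesis rho_img : forall p y, `|y - ch p p| <= 2 * rho p -> chart_img (ch p) y.

Lemma compact_core p : compact (core rho 2 p).
Proof.
have -> : core rho 2 p = chart_inv (ch p) @` [set y | `|y - ch p p| <= 2 * rho p].
  apply/seteqP; split=> [x [px xr]|_ [y yr <-]] /=.
    by exists (ch p x) => //; rewrite chart_mapK.
  have iy := rho_img yr.
  by split; [exact: chart_inv_dom|rewrite chart_invK].
apply: continuous_compact.
  apply: continuous_in_subspaceT => y /set_mem /rho_img.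
  exact: chart_inv_continuous.
apply: bounded_closed_compact.
  exists (2 * rho p + `|ch p p|); split; first exact: num_real.
  move=> B hB y /= hy; apply: le_trans (ltW hB).
  by rewrite -[y in `|y|](subrK (ch p p)); apply: le_trans (ler_normD _ _) _; rewrite lerD2r.
have -> : [set y : 'rV[R]_m | `|y - ch p p| <= 2 * rho p] =
    closed_ball_ Num.norm (ch p p) (2 * rho p).
  by apply/seteqP; split=> y /=; rewrite /closed_ball_ /= distrC.
exact: closed_closed_ball_.
Qed.

(** Compactness is used through near-coverings, with the filter of all finite sets
    that contain a given one. *)
Lemma finite_atlas : exists D : {fset M}, forall x, exists2 p, p \in D & core rho 1 p x.
Proof.
pose O p := [set x | chart_dom (ch p) x /\ `|ch p x - ch p p| < rho p].
have oO p : open (O p).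
  rewrite openE => x [px xr]; near=> y; split; near: y; first exact: near_chart_dom.
  have := chart_map_continuous px; move=> /cvgrPdist_lt/(_ (rho p - `|ch p x - ch p p|)).
  rewrite subr_gt0 => /(_ xr); apply: filterS => y hy.
  have := ler_distD (ch p x) (ch p y) (ch p p); rewrite (distrC (ch p y) (ch p x)); lra.
pose F : set_system {fset M} :=
  filter_from setT (fun D0 : {fset M} => [set D : {fset M} | (D0 `<=` D)%fset]).
have FF : Filter F.
  apply: filter_from_filter; first by exists fset0.
  move=> D1 D2 _ _; exists (D1 `|` D2)%fset => // D /=.
  by rewrite fsubUset => /andP[].
have := M_compact => /compact_near_coveringP cM.
have loc x : [set: M] x ->
    \forall y \near x & D \near F, exists2 p, p \in D & core rho 1 p y.
  move=> _; exists (O x, [set D : {fset M} | ([fset x] `<=` D)%fset]).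
    split => /=; last by exists [fset x]%fset.
    apply: open_nbhs_nbhs; split => //.
    by split; [exact: chart_at_dom|rewrite subrr normr0].
  move=> [y D] /= [[xy hy] xD]; exists x; first by rewrite -fsub1set.
  by split => //; rewrite mul1r ltW.
have [D _ hD] := cM _ F (fun D x => exists2 p, p \in D & core rho 1 p x) FF loc.
by exists D => x; apply: (hD D) => //=; exact: fsubset_refl.
Unshelve. all: by end_near. Qed.

End FiniteAtlas.

Section Metric.
Context {R : realType} {m : nat} {M : topologicalType}.
Variable X : smooth_manifold R m M.
Hypothesis M_compact : compact [set: M].
Local Notation ch p := (chart_at X p).
Variable rho : M -> R.
Hypothesis rho_gt0 : forall p, 0 < rho p.
Hypothesis rho_img : forall p y, `|y - ch p p| <= 2 * rho p -> chart_img (ch p) y.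
Variable D : {fset M}.
Hypothesis D_cover : forall x, exists2 p, p \in D & core X rho 1 p x.

(* A point is determined by its bump values and its bump-weighted coordinates,
   which are continuous on all of [M]. *)
Let bump (p x : M) : R :=
  if `[< chart_dom (ch p) x >] then Num.max 0 (2 * rho p - `|ch p x - ch p p|) else 0.
Let scaled (p x : M) : 'rV[R]_m := bump p x *: ch p x.

Let bumpE p x : chart_dom (ch p) x ->
  bump p x = Num.max 0 (2 * rho p - `|ch p x - ch p p|).
Proof. by move=> px; rewrite /bump asboolT. Qed.

Let bump_out p x : ~ core X rho 2 p x -> bump p x = 0.
Proof.
move=> nx; rewrite /bump; case: asboolP => // px.
apply/max_idPl; rewrite subr_le0 leNgt; apply/negP => h.
by apply: nx; split => //; exact: ltW.
Qed.

Let near_out p x : ~ core X rho 2 p x -> \forall y \near x, ~ core X rho 2 p y.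
Proof.
move=> nx; apply: open_nbhs_nbhs; split => //.
apply: closed_openC; apply: compact_closed; first exact: (manifold_hausdorff X).
exact: (@compact_core _ _ _ _ _ rho_img p).
Qed.

Let bump_cvg p x : bump p @ x --> bump p x.
Proof.
apply/cvgrPdist_lt => e e0.
have [px|npx] := pselect (chart_dom (ch p) x); last first.
  have nx : ~ core X rho 2 p x by case.
  by apply: filterS (near_out nx) => y ny; rewrite !bump_out // subrr normr0.
have /cvgrPdist_lt/(_ e e0) := chart_map_continuous px.
apply: filterS2 (near_chart_dom px) => y py hy.
rewrite !bumpE //; apply: le_lt_trans hy.
have h1 := ler_distD (ch p x) (ch p y) (ch p p).
have h2 := ler_distD (ch p y) (ch p x) (ch p p).
rewrite (distrC (ch p y) (ch p x)) in h1.
rewrite ler_norml; case: (leP 0 (2 * rho p - `|ch p x - ch p p|));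
  case: (leP 0 (2 * rho p - `|ch p y - ch p p|)); move=> ? ?; apply/andP; split; lra.
Qed.

Let scaled_cvg p x : scaled p @ x --> scaled p x.
Proof.
have [px|npx] := pselect (chart_dom (ch p) x).
  by apply: cvgZ; [exact: bump_cvg|exact: chart_map_continuous].
have nx : ~ core X rho 2 p x by case.
apply/cvgrPdist_lt => e e0.
by apply: filterS (near_out nx) => y ny; rewrite /scaled !bump_out // !scale0r subrr normr0.
Qed.

Lemma atlas_metric : exists d : M -> M -> R, compatible_metric d.
Proof.
pose d x y := \sum_(p <- D) (`|bump p x - bump p y| + `|scaled p x - scaled p y|).
exists d; apply: (continuous_separating_metric M_compact).
- by move=> x; rewrite /d big1 // => p _; rewrite !subrr !normr0 addr0.
- by move=> x y; apply: eq_bigr => p _; rewrite distrC [in X in _ + X]distrC.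
- move=> x y z; rewrite /d -big_split /=; apply: ler_sum => p _.
  by rewrite addrACA; apply: lerD; apply: ler_distD.
- move=> x e e0.
  have H : (d x y @[y --> x]) --> d x x.
    apply: (@cvg_big R M +%R 0 xpredT _ M (nbhs x) D (fun p y =>
      `|bump p x - bump p y| + `|scaled p x - scaled p y|)) => [|p _].
      exact: add_continuous.
    apply: cvgD; apply: cvg_norm; apply: cvgB; try exact: cvg_cst.
      exact: bump_cvg.
    exact: scaled_cvg.
  have dxx : d x x = 0 by rewrite /d big1 // => p _; rewrite !subrr !normr0 addr0.
  rewrite dxx in H.
  exact: (cvgr_lt _ H _ e0).
- move=> x y dxy.
  have [p pD [px xr]] := D_cover x.
  have : forall q, q \in (D : seq M) -> `|bump q x - bump q y| + `|scaled q x - scaled q y| = 0.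
    have := dxy; move/eqP; rewrite psumr_eq0 => [/allP h q qD|q _].
      by apply/eqP; exact: (h q qD).
    by rewrite addr_ge0.
  move=> /(_ p pD) h.
  have b0 : bump p x = bump p y.
    by apply/eqP; rewrite -subr_eq0 -normr_le0; have := normr_ge0 (scaled p x - scaled p y); lra.
  have s0 : scaled p x = scaled p y.
    by apply/eqP; rewrite -subr_eq0 -normr_le0; have := normr_ge0 (bump p x - bump p y); lra.
  have bx : 0 < bump p x.
    by rewrite bumpE // lt_max; apply/orP; right; have := rho_gt0 p; lra.
  have py : chart_dom (ch p) y.
    by move: bx; rewrite b0 /bump; case: asboolP => //; rewrite ltxx.
  have : ch p x = ch p y.
    by move: s0; rewrite /scaled -b0; apply: scalerI; rewrite gt_eqF.
  by move=> /(congr1 (chart_inv (ch p))); rewrite !chart_mapK.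
Qed.

End Metric.

Lemma manifold_metric (R : realType) (m : nat) (M : topologicalType)
    (X : smooth_manifold R m M) : compact [set: M] ->
  exists d : M -> M -> R, compatible_metric d.
Proof.
move=> M_compact; have [rho hrho] := chart_radius X.
have rho0 p : 0 < rho p by case: (hrho p).
have [D hD] := finite_atlas X M_compact rho0.
apply: (atlas_metric M_compact rho0 _ hD) => p.
by case: (hrho p).
Qed.

(** * Constants uniform over a finite atlas *)

Section UniformContinuity.
Context {R : realType} {M : topologicalType}.
Hypothesis M_compact : compact [set: M].
Variables (d : M -> M -> R) (f : M -> M).
Hypothesis d_metric : compatible_metric d.
Hypothesis f_cont : continuous f.

Lemma uniform_continuity e : 0 < e ->
  exists2 del, 0 < del & forall x y, d x y < del -> d (f x) (f y) < e.
Proof.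
move=> e0.
have [del del0 h] : exists2 del, 0 < del &
    forall x, [set: M] x -> forall y, d x y < del -> d (f x) (f y) < e.
  apply: (compact_uniform (P := fun del x => forall y, d x y < del -> d (f x) (f y) < e) M_compact).
    by move=> r r' x rr' h y xy; apply: h; exact: lt_le_trans rr'.
  move=> x _; have e20 : 0 < e / 2 by rewrite divr_gt0.
  have [s s0 hs] := continuous_dist d_metric f_cont x e20.
  exists (s / 2); first by rewrite divr_gt0.
  apply: filterS (dist_near d_metric x (divr_gt0 s0 (ltr0n _ 2))) => y xy _ z yz.
  have xz : d x z < s by have := dist_triangle d_metric x y z; lra.
  have xy' : d x y < s by lra.
  have := dist_triangle d_metric (f y) (f x) (f z).
  by have := hs _ xz; have := hs _ xy'; rewrite (dist_sym d_metric (f y) (f x)); lra.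
by exists del => // x y; exact: h.
Qed.

Lemma pseudo_orbit_near N e : 0 < e -> exists2 del, 0 < del &
  forall x, pseudo_orbit d f del x ->
  forall i n, (n <= N)%N -> d (iter n f (x i)) (x (i + n%:Z)) < e.
Proof.
elim: N e => [|N IH] e e0.
  exists 1 => // x _ i n; rewrite leqn0 => /eqP ->.
  by rewrite addr0 (dist_refl d_metric).
have e20 : 0 < e / 2 by rewrite divr_gt0.
have [s s0 hs] := uniform_continuity e20.
have [del1 del10 h1] := IH _ s0.
have [del2 del20 h2] := IH _ e0.
exists (Num.min (Num.min del1 del2) (e / 2)).
  by rewrite !lt_min del10 del20 e20.
move=> x px i n.
have px1 : pseudo_orbit d f del1 x.
  by move=> j; apply: lt_le_trans (px j) _; rewrite !ge_min lexx.
have px2 : pseudo_orbit d f del2 x.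
  by move=> j; apply: lt_le_trans (px j) _; rewrite !ge_min lexx orbT.
have px3 j : d (f (x j)) (x (j + 1)) < e / 2.
  by apply: lt_le_trans (px j) _; rewrite ge_min lexx orbT.
rewrite leq_eqVlt => /orP[/eqP ->|]; last by rewrite ltnS; exact: h2.
rewrite iterS; have := hs _ _ (h1 x px1 i N (leqnn N)).
have := px3 (i + N%:Z); have -> : i + N%:Z + 1 = i + N.+1%:Z by lia.
have := dist_triangle d_metric (f (iter N f (x i))) (f (x (i + N%:Z))) (x (i + N.+1%:Z)).
lra.
Qed.

End UniformContinuity.

Section ChartConstants.
Context {R : realType} {m : nat} {M : topologicalType}.
Variable X : smooth_manifold R m M.
Local Notation ch p := (chart_at X p).
Variable rho : M -> R.
Hypothesis rho_img : forall p y, `|y - ch p p| <= 2 * rho p -> chart_img (ch p) y.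
Variable D : {fset M}.
Local Notation core2 := (core X rho 2).

Lemma near_core p x (P : set 'rV[R]_m) : core2 p x ->
  (\forall y \near ch p x, P y) -> \forall z \near x, P (ch p z).
Proof. by move=> [px _] nP; exact: (chart_map_continuous px nP). Qed.

Lemma uniform_core (Q : R -> M -> M -> Prop) :
  (forall r r' p x, r' <= r -> Q r p x -> Q r' p x) ->
  (forall p x, core2 p x -> exists2 r, 0 < r & \forall y \near x, core2 p y -> Q r p y) ->
  exists2 r, 0 < r & forall p, p \in D -> forall x, core2 p x -> Q r p x.
Proof.
move=> mono loc.
apply: (fset_uniform (P := fun r p => forall x, core2 p x -> Q r p x)).
  by move=> r r' p rr' h x px; apply: mono rr' _; exact: h.
move=> p _ /=; apply: (compact_uniform (P := fun r x => Q r p x) (@compact_core _ _ _ _ _ rho_img p)).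
  by move=> r r' x; exact: mono.
exact: loc.
Qed.

Section Metric.
Variable d : M -> M -> R.
Hypothesis d_metric : compatible_metric d.

Lemma uniform_chart_close e : 0 < e -> exists2 del, 0 < del &
  forall p, p \in D -> forall x, core2 p x -> forall y, d x y < del ->
    chart_dom (ch p) y /\ `|ch p x - ch p y| < e.
Proof.
move=> e0; apply: (uniform_core (Q := fun del p x => forall y, d x y < del ->
    chart_dom (ch p) y /\ `|ch p x - ch p y| < e)).
  by move=> r r' p x rr' h y xy; apply: h; exact: lt_le_trans rr'.
move=> p x px; have e20 : 0 < e / 2 by rewrite divr_gt0.
have nx : \forall y \near x, chart_dom (ch p) y /\ `|ch p x - ch p y| < e / 2.
  have /cvgrPdist_lt/(_ _ e20) := chart_map_continuous px.1.
  by apply: filterS2 (near_chart_dom px.1) => y py hy.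
have [s s0 hs] := (dist_nbhs d_metric _ _).1 nx.
exists (s / 2); first by rewrite divr_gt0.
apply: filterS (dist_near d_metric x (divr_gt0 s0 (ltr0n _ 2))) => y xy py z yz.
have xz : d x z < s by have := dist_triangle d_metric x y z; lra.
have xy' : d x y < s by lra.
have [_ h1] := hs _ xy'; have [pz h2] := hs _ xz; split; first exact: pz.
have := ler_distD (ch p x) (ch p y) (ch p z); rewrite (distrC (ch p y) (ch p x)); lra.
Qed.

Lemma uniform_chart_inv_close e : 0 < e -> exists2 r, 0 < r &
  forall p, p \in D -> forall x, core2 p x -> forall y, `|y - ch p x| < r ->
    chart_img (ch p) y /\ d x (chart_inv (ch p) y) < e.
Proof.
move=> e0; apply: (uniform_core (Q := fun r p x => forall y, `|y - ch p x| < r ->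
    chart_img (ch p) y /\ d x (chart_inv (ch p) y) < e)).
  by move=> r r' p x rr' h y xy; apply: h; exact: lt_le_trans rr'.
move=> p x px; have e20 : 0 < e / 2 by rewrite divr_gt0.
have nx : \forall y \near ch p x, chart_img (ch p) y /\ d x (chart_inv (ch p) y) < e / 2.
  have := near_chart_inv px.1 (dist_near d_metric x e20).
  by apply: filterS2 (near_chart_img px.1) => y py hy.
move/nbhs_ballP: nx => [s /= s0 hs].
have s20 : 0 < s / 2 by rewrite divr_gt0.
exists (s / 2) => //.
have n1 : \forall y \near x, `|ch p x - ch p y| < s / 2.
  by have /cvgrPdist_lt/(_ _ s20) := chart_map_continuous px.1.
apply: filterS2 n1 (dist_near d_metric x e20) => y py dxy cy z yz.
have [iz hz] : chart_img (ch p) z /\ d x (chart_inv (ch p) z) < e / 2.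
  apply: hs; rewrite -ball_normE /=.
  have := ler_distD (ch p y) (ch p x) z; rewrite (distrC (ch p y) z); lra.
split => //; have := dist_triangle d_metric y x (chart_inv (ch p) z).
by rewrite (dist_sym d_metric y x); lra.
Qed.

End Metric.

Variable f : M -> M.
Hypothesis f_C1 : C1_on X setT f.

Let f_cont : continuous f.
Proof. by move=> x; exact: f_C1.1. Qed.

Lemma uniform_core_pair (Q : R -> M -> M -> M -> Prop) :
  (forall r r' p q x, r' <= r -> Q r p q x -> Q r' p q x) ->
  (forall p q x, core2 p x -> core2 q (f x) ->
    exists2 r, 0 < r & \forall y \near x, core2 p y -> core2 q (f y) -> Q r p q y) ->
  exists2 r, 0 < r & forall p q, p \in D -> q \in D -> forall x, core2 p x ->
    core2 q (f x) -> Q r p q x.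
Proof.
move=> mono loc.
have [r r0 hr] : exists2 r, 0 < r & forall p, p \in D ->
    (forall q, q \in D -> forall x, core2 p x -> core2 q (f x) -> Q r p q x).
  apply: (fset_uniform (P := fun r p =>
      forall q, q \in D -> forall x, core2 p x -> core2 q (f x) -> Q r p q x)).
    by move=> r r' p rr' h q qD x px qx; apply: mono rr' _; exact: h.
  move=> p _; apply: (fset_uniform (P := fun r q =>
      forall x, core2 p x -> core2 q (f x) -> Q r p q x)).
    by move=> r r' q rr' h x px qx; apply: mono rr' _; exact: h.
  move=> q _.
  have clq s : closed (core2 s).
    by apply: compact_closed; [exact: (manifold_hausdorff X)|exact: (@compact_core _ _ _ _ _ rho_img s)].
  have cK : compact (core2 p `&` f @^-1` core2 q).
    apply: subclosed_compact (@compact_core _ _ _ _ _ rho_img p) _; last by move=> x [].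
    by apply: closedI => //; apply: closed_comp => // x _; exact: f_cont.
  have [r r0 hr] : exists2 r, 0 < r & forall x, (core2 p `&` f @^-1` core2 q) x -> Q r p q x.
    apply: (compact_uniform (P := fun r x => Q r p q x) cK).
      by move=> r r' x; exact: mono.
    move=> x [px qx]; have [r r0 h] := loc p q x px qx.
    by exists r => //; apply: filterS h => y h [py qy]; exact: h.
  by exists r => // x px qx; apply: hr.
by exists r => // p q pD qD x px qx; exact: hr.
Qed.

Lemma near_diff_close p q x e : core2 p x -> core2 q (f x) -> 0 < e ->
  \forall y \near ch p x, [/\ chart_img (ch p) y, chart_dom (ch q) (f (chart_inv (ch p) y)),
    differentiable (in_charts (ch p) (ch q) f) y &
    forall v, `|'d (in_charts (ch p) (ch q) f) y v - 'd (in_charts (ch p) (ch q) f) (ch p x) v|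
       <= e * `|v|].
Proof.
move=> [px _] [qx _] e0.
have n1 := near_chart_img px.
have n2 : \forall y \near ch p x, chart_dom (ch q) (f (chart_inv (ch p) y)).
  apply: (@near_chart_inv _ _ _ (ch p) x (f @^-1` chart_dom (ch q)) px).
  by apply: f_cont; exact: near_chart_dom.
have n3 := diff_cont_uniform
  (C1_diff_continuous f_C1 (chart_at_atlas X p) (chart_at_atlas X q) px qx) e0.
apply: filterS3 n1 n2 n3 => y y1 y2 y3; split.
- exact: y1.
- exact: y2.
- rewrite -(chart_invK y1).
  apply: (C1_differentiable f_C1 (chart_at_atlas X p) (chart_at_atlas X q)) => //.
  exact: chart_inv_dom.
- exact: y3.
Qed.

(** A uniform version of the continuity of the derivative, which provides both the
    remainder estimate of the Newton iteration and the comparison of derivatives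
    along a pseudo-orbit and along a nearby orbit. *)
Lemma uniform_diff_close e : 0 < e -> exists2 r, 0 < r &
  forall p q, p \in D -> q \in D -> forall x, core2 p x -> core2 q (f x) ->
  forall y, `|y - ch p x| < r ->
  [/\ chart_img (ch p) y, chart_dom (ch q) (f (chart_inv (ch p) y)),
    differentiable (in_charts (ch p) (ch q) f) y &
    forall v, `|'d (in_charts (ch p) (ch q) f) y v - 'd (in_charts (ch p) (ch q) f) (ch p x) v|
       <= e * `|v|].
Proof.
move=> e0; apply: (uniform_core_pair (Q := fun r p q x => forall y, `|y - ch p x| < r ->
  [/\ chart_img (ch p) y, chart_dom (ch q) (f (chart_inv (ch p) y)),
    differentiable (in_charts (ch p) (ch q) f) y &
    forall v, `|'d (in_charts (ch p) (ch q) f) y v - 'd (in_charts (ch p) (ch q) f) (ch p x) v|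
       <= e * `|v|])).
  by move=> r r' p q x rr' h y xy; apply: h; exact: lt_le_trans rr'.
move=> p q x px qx; have e20 : 0 < e / 2 by rewrite divr_gt0.
have /nbhs_ballP[s /= s0 hs] := near_diff_close px qx e20.
have s20 : 0 < s / 2 by rewrite divr_gt0.
exists (s / 2) => //.
have n1 : \forall y \near x, `|ch p x - ch p y| < s / 2.
  by have /cvgrPdist_lt/(_ _ s20) := chart_map_continuous px.1.
apply: filterS n1 => z xz pz qz y yz.
have by1 : ball (ch p x) s y.
  rewrite -ball_normE /=.
  have := ler_distD (ch p z) (ch p x) y; rewrite (distrC (ch p z) y); lra.
have bz : ball (ch p x) s (ch p z) by rewrite -ball_normE /=; lra.
have [y1 y2 y3 y4] := hs _ by1; have [_ _ _ z4] := hs _ bz.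
split; [exact: y1|exact: y2|exact: y3|move=> v].
apply: le_trans (ler_distD ('d (in_charts (ch p) (ch q) f) (ch p x) v) _ _) _.
have -> : e * `|v| = e / 2 * `|v| + e / 2 * `|v| by rewrite -mulrDl -splitr.
by apply: lerD; [exact: y4|rewrite distrC; exact: z4].
Qed.

Lemma uniform_diff_bounded : exists2 L, 0 < L &
  forall p q, p \in D -> q \in D -> forall x, core2 p x -> core2 q (f x) ->
  forall v, `|'d (in_charts (ch p) (ch q) f) (ch p x) v| <= L * `|v|.
Proof.
have [r r0 hr] : exists2 r, 0 < r &
  forall p q, p \in D -> q \in D -> forall x, core2 p x -> core2 q (f x) ->
  forall v, r * `|'d (in_charts (ch p) (ch q) f) (ch p x) v| <= `|v|.
  apply: (uniform_core_pair (Q := fun r p q x =>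
     forall v, r * `|'d (in_charts (ch p) (ch q) f) (ch p x) v| <= `|v|)).
    by move=> r r' p q x rr' h v; apply: le_trans (h v); exact: ler_wpM2r.
  move=> p q x px qx.
  set L0 := 'd (in_charts (ch p) (ch q) f) (ch p x).
  pose B := \sum_k `|L0 (delta_mx 0 k) - 0|.
  have B0 : 0 <= B by apply: sumr_ge0.
  have bd v : `|L0 v| <= B * `|v|.
    have := linear_row_leB L0 (\0%R : {linear 'rV[R]_m -> 'rV[R]_m}) v.
    by rewrite /= subr0.
  exists (B + 1)^-1; first by rewrite invr_gt0; lra.
  have := near_core px (near_diff_close px qx (ltr01 : 0 < (1 : R))).
  apply: filterS => y [_ _ _ h] _ _ v.
  rewrite ler_pdivrMl; last lra.
  set w := 'd _ _ v.
  have -> : w = (w - L0 v) + L0 v by rewrite subrK.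
  apply: le_trans (ler_normD _ _) _.
  have -> : (B + 1) * `|v| = 1 * `|v| + B * `|v| by rewrite mulrDl addrC.
  by apply: lerD; [exact: h|exact: bd].
exists r^-1; first by rewrite invr_gt0.
move=> p q pD qD x px qx v; rewrite mulrC ler_pdivlMr // mulrC.
exact: hr.
Qed.

End ChartConstants.

Section NormComparison.
Context {R : realType} {m : nat} {M : topologicalType}.
Variable X : smooth_manifold R m M.
Variable g : riemannian_metric X.
Local Notation ch p := (chart_at X p).
Variable rho : M -> R.
Hypothesis rho_img : forall p y, `|y - ch p p| <= 2 * rho p -> chart_img (ch p) y.
Variable D : {fset M}.
Local Notation core2 := (core X rho 2).

Lemma gram_suml (G : 'M[R]_m) (a : 'I_m -> R) (u : 'I_m -> 'rV[R]_m) w :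
  gram G (\sum_j a j *: u j) w = \sum_j a j * gram G (u j) w.
Proof.
rewrite /gram !mulmx_suml summxE; apply: eq_bigr => j _.
by rewrite -!scalemxAl mxE.
Qed.

Lemma gram_sumr (G : 'M[R]_m) (a : 'I_m -> R) (u : 'I_m -> 'rV[R]_m) w :
  gram G w (\sum_j a j *: u j) = \sum_j a j * gram G w (u j).
Proof.
rewrite /gram linear_sum mulmx_sumr summxE; apply: eq_bigr => j _.
by rewrite linearZ -scalemxAr mxE.
Qed.

Lemma gramZ (G : 'M[R]_m) a u : gram G (a *: u) (a *: u) = a ^+ 2 * gram G u u.
Proof.
by rewrite /gram linearZ -!scalemxAl -scalemxAr !mxE mulrA expr2.
Qed.

(** The Riemannian metric at [x], in the components of the chart at [p]. *)
Definition chart_gram p x (u w : 'rV[R]_m) : R :=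
  gram (g x) (to_tangent X (ch p) x u) (to_tangent X (ch p) x w).

Lemma chart_gram_continuous p x u w : chart_dom (ch p) x ->
  {for x, continuous (fun y => chart_gram p y u w)}.
Proof.
move=> px.
have C := metric_smooth g (chart_at_atlas X p) u w 0%N (ch p x) (chart_map_img px).
pose h y := gram (g (chart_inv (ch p) y))
  (tangent_of_chart X (ch p) y u) (tangent_of_chart X (ch p) y w).
have hE y : chart_dom (ch p) y -> h (ch p y) = chart_gram p y u w.
  move=> py; rewrite /h /chart_gram /tangent_of_chart chart_mapK //.
have ch1 : (h \o ch p) @ x --> chart_gram p x u w.
  rewrite -(hE x px).
  apply: (@continuous_comp _ _ _ (ch p) h x (chart_map_continuous px)).
  exact: C.
have nE : \forall y \near x, (h \o ch p) y = chart_gram p y u w.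
  by apply: filterS (near_chart_dom px) => y py; exact: hE.
exact: (cvg_trans (near_eq_cvg nE) ch1).
Qed.

Lemma chart_gramE p x v : chart_gram p x v v =
  \sum_j v 0 j * \sum_k (v 0 k * chart_gram p x (delta_mx 0 j) (delta_mx 0 k)).
Proof.
rewrite /chart_gram.
have E w : to_tangent X (ch p) x w = \sum_j w 0 j *: to_tangent X (ch p) x (delta_mx 0 j).
  by rewrite {1}(row_sum_delta w) linear_sum; apply: eq_bigr => k _; exact: linearZ.
rewrite {1}(E v) gram_suml; apply: eq_bigr => j _; congr (_ * _).
by rewrite (E v) gram_sumr.
Qed.

Lemma chart_gram_gt0 p x v : chart_dom (ch p) x -> v != 0 -> 0 < chart_gram p x v v.
Proof.
move=> px v0; apply: metric_pos.
have [T [_ K]] := to_tangent_bij (chart_at_atlas X p) px.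
apply: contra_neq v0 => T0; rewrite -(K v) T0.
by have := K 0; rewrite linear0.
Qed.

Lemma chart_gram_cvg p x v : chart_dom (ch p) x ->
  (chart_gram p z.1 z.2 z.2) @[z --> (x, v)] --> chart_gram p x v v.
Proof.
move=> px; under eq_cvg do rewrite chart_gramE; rewrite chart_gramE.
have cc j : (fun z : M * 'rV[R]_m => z.2 0 j) @ (x, v) --> v 0 j.
  apply: (@cvg_comp _ _ _ snd (fun w : 'rV[R]_m => w 0 j) _ (nbhs v)); first exact: cvg_snd.
  exact: coord_continuous.
apply: (@cvg_big R _ +%R 0 xpredT _ _ (nbhs (x, v)) (index_enum 'I_m)
  (fun j z => z.2 0 j * \sum_k (z.2 0 k * chart_gram p z.1 (delta_mx 0 j) (delta_mx 0 k)))).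
  exact: add_continuous.
move=> j _; apply: cvgM; first exact: cc.
apply: (@cvg_big R _ +%R 0 xpredT _ _ (nbhs (x, v)) (index_enum 'I_m)
  (fun k z => z.2 0 k * chart_gram p z.1 (delta_mx 0 j) (delta_mx 0 k))).
  exact: add_continuous.
move=> k _; apply: cvgM; first exact: cc.
apply: (@cvg_comp _ _ _ fst (fun y => chart_gram p y (delta_mx 0 j) (delta_mx 0 k)) _ (nbhs x)).
  exact: cvg_fst.
exact: chart_gram_continuous.
Qed.

Lemma compact_sphere : compact [set v : 'rV[R]_m | `|v| = 1].
Proof.
apply: bounded_closed_compact.
  exists 1; split; first exact: num_real.
  by move=> B hB y /= ->; exact: ltW.
have -> : [set v : 'rV[R]_m | `|v| = 1] = Num.norm @^-1` [set 1] by [].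
apply: closed_comp; last exact: closed_eq.
by move=> y _; exact: norm_continuous.
Qed.

(** The metric is continuous and positive on the compact set of pairs of a point of
    the core and a unit vector; other vectors follow by homogeneity. *)
Lemma uniform_chart_gram : exists2 r, 0 < r & forall p, p \in D -> forall x, core2 p x ->
  forall v, r * `|v| ^+ 2 <= chart_gram p x v v /\ r * chart_gram p x v v <= `|v| ^+ 2.
Proof.
suff [r r0 hr] : exists2 r, 0 < r & forall p, p \in D -> forall z : M * 'rV[R]_m,
    (core2 p `*` [set v | `|v| = 1]) z ->
    r <= chart_gram p z.1 z.2 z.2 /\ r * chart_gram p z.1 z.2 z.2 <= 1.
  exists r => // p pD x px v.
  have [->|v0] := eqVneq v 0.
    rewrite normr0 expr0n /= mulr0 /chart_gram linear0 /gram mul0mx mul0mx mxE mulr0.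
    by split.
  have nv : 0 < `|v| by rewrite normr_gt0.
  have [] := hr p pD (x, `|v|^-1 *: v).
    by split => //=; rewrite normrZ normfV normr_id mulVf // gt_eqF.
  rewrite /= /chart_gram linearZ gramZ -/(chart_gram p x v v) exprVn => h1 h2.
  have n2 : 0 < `|v| ^+ 2 by rewrite exprn_gt0.
  split.
    by move: h1; rewrite ler_pdivlMl // mulrC.
  by move: h2; rewrite mulrCA ler_pdivrMl // mulr1.
apply: (fset_uniform (P := fun r p => forall z : M * 'rV[R]_m,
    (core2 p `*` [set v | `|v| = 1]) z ->
    r <= chart_gram p z.1 z.2 z.2 /\ r * chart_gram p z.1 z.2 z.2 <= 1)).
  move=> r r' p rr' h z pz; have [h1 h2] := h z pz; split; first exact: le_trans h1.
  apply: le_trans h2; apply: ler_wpM2r => //; rewrite ltW //.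
  have [[pz1 _] z2] := pz; apply: chart_gram_gt0 => //.
  by rewrite -normr_gt0 z2.
move=> p _ /=.
have cK : compact (core2 p `*` [set v : 'rV[R]_m | `|v| = 1]).
  by apply: compact_setX; [exact: (@compact_core _ _ _ _ _ rho_img p)|exact: compact_sphere].
have pos (z : M * 'rV[R]_m) : (core2 p `*` [set v | `|v| = 1]) z -> 0 < chart_gram p z.1 z.2 z.2.
  by move=> [[pz1 _] z2]; apply: chart_gram_gt0 => //; rewrite -normr_gt0 z2.
have [r r0 hr] : exists2 r, 0 < r & forall z : M * 'rV[R]_m,
    (core2 p `*` [set v | `|v| = 1]) z ->
    0 < chart_gram p z.1 z.2 z.2 -> r <= chart_gram p z.1 z.2 z.2 /\ r * chart_gram p z.1 z.2 z.2 <= 1.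
  apply: (compact_uniform (P := fun r (z : M * 'rV[R]_m) =>  0 < chart_gram p z.1 z.2 z.2 ->
    r <= chart_gram p z.1 z.2 z.2 /\ r * chart_gram p z.1 z.2 z.2 <= 1) cK).
    move=> r r' z rr' h gz; have [h1 h2] := h gz; split; first exact: le_trans h1.
    by apply: le_trans h2; apply: ler_wpM2r => //; exact: ltW.
  move=> [x v] [px v1] /=.
  have a0 := pos (x, v) (conj px v1); rewrite /= in a0.
  set a := chart_gram p x v v in a0.
  exists (Num.min (a / 2) (2 * a)^-1); first by rewrite lt_min divr_gt0 //= invr_gt0; lra.
  have C := @chart_gram_cvg p x v px.1; rewrite -/a in C.
  have a2 : a / 2 < a by lra.
  have a3 : a < 2 * a by lra.
  apply: filterS2 (cvgr_gt _ C _ a2) (cvgr_lt _ C _ a3) => z /= h1 h2 _ gz; split.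
    by rewrite ge_min (ltW h1).
  apply: (@le_trans _ _ ((2 * a)^-1 * chart_gram p z.1 z.2 z.2)).
    by apply: ler_wpM2r; [exact: ltW|rewrite ge_min lexx orbT].
  by rewrite ler_pdivrMl ?mulr1 ?(ltW h2) //; lra.
by exists r => // z pz; apply: hr => //; exact: pos.
Qed.

Lemma uniform_tangent_norm : exists2 r, 0 < r & forall p, p \in D -> forall x, core2 p x ->
  forall v, r * `|v| <= tangent_norm g x (to_tangent X (ch p) x v) /\
    r * tangent_norm g x (to_tangent X (ch p) x v) <= `|v|.
Proof.
have [r r0 hr] := uniform_chart_gram.
exists (Num.sqrt r); first by rewrite sqrtr_gt0.
move=> p pD x px v; have [h1 h2] := hr p pD x px v.
have E : Num.sqrt (`|v| ^+ 2) = `|v| by rewrite sqrtr_sqr normr_id.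
rewrite /tangent_norm -/(chart_gram p x v v) -{1 2}E -!(sqrtrM _ (ltW r0)).
by split; [exact: (ler_wsqrtr h1)|exact: (ler_wsqrtr h2)].
Qed.

End NormComparison.

(** * Shadowing for Anosov endomorphisms *)

Section OrbitCocycle.
Context {R : realType} {m : nat} {M : topologicalType}.
Variable X : smooth_manifold R m M.
Variable g : riemannian_metric X.
Local Notation ch p := (chart_at X p).
Variable f : M -> M.
Hypothesis f_C1 : C1_on X setT f.

(** Defined for arbitrary sequences [y], because derivatives along a pseudo-orbit
    are compared with those along a nearby orbit. *)
Definition chart_cocycle (k y : int -> M) (i : int) : {linear 'rV[R]_m -> 'rV[R]_m} :=
  'd (in_charts (ch (k i)) (ch (k (i + 1))) f) (ch (k i) (y i)).

Variables (k y : int -> M).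
Hypothesis y_orbit : is_orbit f y.
Hypothesis ky : forall i, chart_dom (ch (k i)) (y i).

Let to i (v : 'rV[R]_m) := to_tangent X (ch (k i)) (y i) v.

Lemma to_tangent_step i v :
  to (i + 1) (chart_cocycle k y i v) = tangent_map X f (y i) (to i v).
Proof.
have ky1 : chart_dom (ch (k (i + 1))) (f (y i)) by rewrite y_orbit.
have := tangent_map_in_charts v f_C1 (chart_at_atlas X (k i)) (chart_at_atlas X (k (i + 1)))
  (ky i) ky1.
by rewrite {1}y_orbit.
Qed.

Lemma to_tangent_cocycle n i v :
  to (i + n%:Z) (cocycle (chart_cocycle k y) n i v) =
    tangent_map X (iter n f) (y i) (to i v).
Proof.
elim: n => [|n IH].
  have -> : i + 0%:Z = i by lia.
  have h := in_charts_id (chart_at_dom X (y i)) (to i v).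
  exact: esym h.
have -> : i + n.+1%:Z = i + n%:Z + 1 by lia.
have [_ ->] := tangent_mapD n (y i) (to i v) f_C1.
rewrite /cocycle -/cocycle to_tangent_step IH.
by have -> : iter n f (y i) = y (i + n%:Z) by exact: orbit_iter.
Qed.

Variables (C lambda r Lam : R) (Es Eu : int -> {vspace 'rV[R]_m}).
Hypothesis C1 : 1 < C.
Hypothesis lambda1 : 1 < lambda.
Hypothesis r0 : 0 < r.
Hypothesis splitting : invariant_splitting X f y Es Eu.
Hypothesis hyperbolic : hyperbolic_splitting g f C lambda y Es Eu.
Hypothesis norm_r : forall i v, r * `|v| <= tangent_norm g (y i) (to i v) /\
  r * tangent_norm g (y i) (to i v) <= `|v|.
Hypothesis Lam_bound : forall i v, `|chart_cocycle k y i v| <= Lam * `|v|.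

(** The invariant splitting of an orbit, read in charts.  The constant [C] grows
    by [r ^- 2] because the Riemannian norm is compared with the norm of the
    components at both ends. *)
Lemma orbit_hyperbolic : hyperbolic_cocycle (chart_cocycle k y)
  (fun i v => to i v \in Es i) (fun i v => to i v \in Eu i)
  (C / r ^+ 2) lambda^-1 Lam.
Proof.
have inv i : exists T, cancel T (to i) /\ cancel (to i) T.
  exact: to_tangent_bij (chart_at_atlas X (k i)) (ky i).
have Cp : 0 < C by have := C1; lra.
have lp n : 0 < lambda ^+ n by rewrite exprn_gt0 //; have := lambda1; lra.
have r2 : 0 < r ^+ 2 by rewrite exprn_gt0.
split.
- exact: Lam_bound.
- move=> i e; have [T [TK KT]] := inv i.
  have [h _ _ _] := splitting i.
  have : to i e \in (Es i + Eu i)%VS by rewrite h memvf.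
  move=> /memv_addP[s sE [u uE eE]].
  exists (T s), (T u); rewrite !TK; split; [exact: sE|exact: uE|].
  have toD a b : to i (a + b) = to i a + to i b by exact: linearD.
  by rewrite -[LHS]KT -[RHS]KT toD !TK eE.
- move=> i u uE; have [_ _ _ h] := splitting i.
  have [T [TK KT]] := inv i; have [T' [TK' KT']] := inv (i + 1).
  move: uE; rewrite -h => /memv_imgP[w wE].
  have -> : linfun (tangent_map X f (y i)) w = tangent_map X f (y i) w by exact: lfunE.
  move=> uw; exists (T w); first by rewrite TK.
  by rewrite -[LHS]KT' to_tangent_step TK -uw KT'.
- move=> n i s n0 sE; have [_ /(_ _ sE)] := hyperbolic i n0.
  rewrite -to_tangent_cocycle.
  have -> : iter n f (y i) = y (i + n%:Z) by exact: orbit_iter.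
  have [h1 _] := norm_r (i + n%:Z) (cocycle (chart_cocycle k y) n i s).
  have [_ h2] := norm_r i s.
  have L0 : 0 < C * lambda ^- n by rewrite mulr_gt0 ?invr_gt0.
  rewrite -/(to i s) => h3.
  have e1 := ler_wpM2l (ltW r0) (le_trans h1 h3).
  have e2 := ler_wpM2l (ltW L0) h2.
  have -> : C / r ^+ 2 * lambda^-1 ^+ n * `|s| = (C * lambda ^- n * `|s|) / r ^+ 2.
    by rewrite exprVn; field; rewrite !gt_eqF.
  by rewrite ler_pdivlMr // expr2; lra.
- move=> n i u n0 uE; have [/(_ _ uE) + _] := hyperbolic i n0.
  rewrite -to_tangent_cocycle.
  have -> : iter n f (y i) = y (i + n%:Z) by exact: orbit_iter.
  have [_ h1] := norm_r (i + n%:Z) (cocycle (chart_cocycle k y) n i u).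
  have [h2 _] := norm_r i u.
  have L0 : 0 < C * lambda ^- n by rewrite mulr_gt0 ?invr_gt0.
  rewrite -/(to i u) => h3.
  have e1 := ler_wpM2l (ltW L0) h3.
  have e2 := ler_wpM2l (ltW L0) h1.
  have e3 := ler_wpM2l (ltW r0) h2.
  have -> : C / r ^+ 2 * lambda^-1 ^+ n * `|cocycle (chart_cocycle k y) n i u| =
      (C * lambda ^- n * `|cocycle (chart_cocycle k y) n i u|) / r ^+ 2.
    by rewrite exprVn; field; rewrite !gt_eqF.
  rewrite ler_pdivlMr // expr2.
  have e4 : C * lambda ^- n * (C^-1 * lambda ^+ n * tangent_norm g (y i) (to i u)) =
      tangent_norm g (y i) (to i u) by field; rewrite !gt_eqF.
  rewrite e4 in e1.
  have := ler_wpM2l (ltW r0) e1; lra.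
Qed.

End OrbitCocycle.

Section AnosovShadowing.
Context {R : realType} {m : nat} {M : topologicalType}.
Variable X : smooth_manifold R m M.
Variable g : riemannian_metric X.
Hypothesis M_compact : compact [set: M].
Local Notation ch p := (chart_at X p).
Variables (f : M -> M) (d : M -> M -> R).
Hypothesis f_anosov : anosov_endomorphism g f.
Hypothesis f_surj : forall y, exists x, f x = y.
Hypothesis d_metric : compatible_metric d.
Variable rho : M -> R.
Hypothesis rho_gt0 : forall p, 0 < rho p.
Hypothesis rho_img : forall p y, `|y - ch p p| <= 2 * rho p -> chart_img (ch p) y.
Variable D : {fset M}.
Variable loc : M -> M.
Hypothesis loc_D : forall x, loc x \in D.
Hypothesis loc_core : forall x, core X rho 1 (loc x) x.
Local Notation core2 := (core X rho 2).

Let f_C1 : C1_on X setT f. Proof. by case: f_anosov. Qed.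
Let f_cont : continuous f. Proof. by move=> x; exact: f_C1.1. Qed.

Let loc_core2 x : core2 (loc x) x.
Proof.
have [h1 h2] := loc_core x; split => //; apply: le_trans h2 _.
by have := rho_gt0 (loc x); lra.
Qed.

Lemma close_core del : 0 < del -> exists2 e, 0 < e & forall x p, p \in D ->
  core X rho 1 p x -> forall y, d x y < e -> core2 p y /\ `|ch p x - ch p y| < del.
Proof.
move=> del0.
have [r r0 hr] : exists2 r, 0 < r & forall p, p \in D -> r <= rho p.
  apply: (fset_uniform (P := fun r p => r <= rho p)) => [r r' x|p _].
    exact: le_trans.
  by exists (rho p).
have m0 : 0 < Num.min r del by rewrite lt_min r0.
have [e e0 he] := uniform_chart_close rho_img D d_metric m0.
exists e => // x p pD [px xr] y xy.
have px2 : core2 p x by split => //; apply: le_trans xr _; have := rho_gt0 p; lra.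
have [py hy] := he p pD x px2 y xy.
have hr1 : `|ch p x - ch p y| < r by apply: lt_le_trans hy _; rewrite ge_min lexx.
split; last by apply: lt_le_trans hy _; rewrite ge_min lexx orbT.
split => //; have := hr p pD.
have := ler_distD (ch p x) (ch p y) (ch p p); rewrite (distrC (ch p y) (ch p x)); lra.
Qed.

(** The response to a jump at time [j] is computed along the orbit that starts at
    [x (j - T)]; it stays close to [x] until time [j + T + 1] when the jumps are
    small, and then so are the derivatives. *)
Lemma pseudo_orbit_impulses : exists2 B, 0 < B & forall tau, 0 < tau ->
  exists (T : nat) (del : R), 0 < del /\ forall x, pseudo_orbit d f del x ->
  forall j e, exists v,
    impulse_response (chart_cocycle X f (loc \o x) x) T B (tau / (2 * T + 2)%:R) j e v.
Proof.
have [_ _ [C [lambda [C1 lam1 hyp]]]] := f_anosov.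
have [r1 r10 hr1] := uniform_tangent_norm g rho_img D.
(* Capping by 1 makes the constant [K] below at least 1. *)
pose r := Num.min r1 1.
have r0 : 0 < r by rewrite lt_min r10 ltr01.
have rr1 : r <= r1 by rewrite ge_min lexx.
have r_1 : r <= 1 by rewrite ge_min lexx orbT.
have [Lam Lam0 hLam] := uniform_diff_bounded rho_img D f_C1.
pose K := C / r ^+ 2; pose mu := lambda^-1.
have r2 : 0 < r ^+ 2 by rewrite exprn_gt0.
have K1 : 1 <= K.
  rewrite ler_pdivlMr // mul1r; apply: le_trans (ltW C1).
  by rewrite exprn_ile1 // ltW.
have mu01 : 0 < mu < 1 by rewrite invr_gt0 invf_lt1 ?lam1 ?andbT; lra.
have K0 : 0 < K by lra.
have [P P0 angle] := splitting_angle (V := 'rV[R]_m) mu01 K0 (ltW Lam0).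
pose B := K * P; have B0 : 0 < B by rewrite mulr_gt0.
exists B => // tau tau0.
have tau20 : 0 < tau / 2 by rewrite divr_gt0.
have [T T0 hT] := linear_geometric_small mu01 B0 tau20.
have T20 : 0 < (2 * T + 2)%:R :> R by rewrite ltr0n addn2.
(* Half of [tau] is spent on the truncation, half on replacing the derivatives
   along an orbit by those along the pseudo-orbit. *)
pose eta := tau / 2 / (2 * T + 2)%:R / B.
have eta0 : 0 < eta by rewrite !divr_gt0.
have [s s0 hs] := uniform_diff_close rho_img D f_C1 eta0.
have [e1 e10 he1] := close_core s0.
have [del1 del10 hdel1] := pseudo_orbit_near M_compact d_metric f_cont (2 * T + 1) e10.
exists T, (Num.min del1 e1); split; first by rewrite lt_min del10.
move=> x px j e.
have px1 : pseudo_orbit d f del1 x.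
  by move=> i; apply: lt_le_trans (px i) _; rewrite ge_min lexx.
pose k i := loc (x i).
have fcore i : core2 (k (i + 1)) (f (x i)).
  apply: (he1 (x (i + 1)) _ (loc_D _) (loc_core _) _ _).1.
  rewrite (dist_sym d_metric); apply: lt_le_trans (px i) _.
  by rewrite ge_min lexx orbT.
have [a oa a0] := full_orbit_through f_surj (x (j - T%:Z)).
pose y i := a (i - (j - T%:Z)).
have oy : is_orbit f y by move=> i; rewrite /y oa; congr a; clear; lia.
pose win i := (j - T%:Z <= i) && (i <= j + T%:Z + 1).
have ynear i : win i -> d (x i) (y i) < e1.
  move=> /andP[i1 i2]; rewrite (dist_sym d_metric).
  have [n iE] : exists n : nat, i = j - T%:Z + n%:Z.
    by exists `|(i - (j - T%:Z))%R|%N; clear -i1; lia.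
  have -> : y i = iter n f (x (j - T%:Z)).
    by rewrite -a0 orbit_iter // /y; congr a; clear -iE; lia.
  by rewrite iE; apply: hdel1 => //; clear -iE i2; lia.
(* On the window the charts are those of [x], so that derivatives along [x] and
   along [y] can be compared there. *)
pose k' i := if win i then k i else loc (y i).
have k'D i : k' i \in D by rewrite /k'; case: ifP => _; exact: loc_D.
have k'core i : core2 (k' i) (y i).
  rewrite /k'; case: ifP => wi; last exact: loc_core2.
  exact: (he1 (x i) _ (loc_D _) (loc_core _) _ (ynear i wi)).1.
have k'dom i : chart_dom (ch (k' i)) (y i) by case: (k'core i).
have [Es [Eu [split_y hyp_y]]] := hyp y oy.
have nr i v : r * `|v| <= tangent_norm g (y i) (to_tangent X (ch (k' i)) (y i) v) /\
    r * tangent_norm g (y i) (to_tangent X (ch (k' i)) (y i) v) <= `|v|.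
  have [h1 h2] := hr1 _ (k'D i) _ (k'core i) v; split.
    by apply: le_trans h1; apply: ler_wpM2r.
  by apply: le_trans h2; apply: ler_wpM2r => //; exact: sqrtr_ge0.
have Lb i v : `|chart_cocycle X f k' y i v| <= Lam * `|v|.
  by apply: hLam => //; rewrite oy.
have hc := orbit_hyperbolic f_C1 oy k'dom C1 lam1 r0 split_y hyp_y nr Lb.
have [v hv] := hyperbolic_impulse j e mu01 K1 P0 T0 hc (angle _ _ _ hc).
exists v.
have AB i w : (`|i - j| <= T)%N ->
    `|chart_cocycle X f k x i w - chart_cocycle X f k' y i w| <= eta * `|w|.
  move=> ij; have wi : win i by clear -ij; rewrite /win; lia.
  have wi1 : win (i + 1) by clear -ij; rewrite /win; lia.
  rewrite /chart_cocycle /k' wi wi1 distrC.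
  have [_ _ _ h] := hs _ _ (loc_D (x i)) (loc_D (x (i + 1))) (x i) (loc_core2 _) (fcore i)
    (ch (k i) (y i)) ltac:(rewrite distrC; exact: (he1 (x i) _ (loc_D _) (loc_core _) _ (ynear i wi)).2).
  exact: h.
have [v0 vb ve] := impulse_perturb (ltW eta0) AB hv; split => // i.
apply: le_trans (ve i) _; apply: ler_wpM2r => //.
have -> : eta * (K * P) = tau / 2 / (2 * T + 2)%:R.
  by rewrite /eta divfK // gt_eqF.
rewrite ler_pdivlMr // mulrDl divfK ?gt_eqF // mulrC -/B.
by rewrite -/B in hT; lra.
Qed.

(** The charts are those of the given pseudo-orbit [x] and are kept during the
    iteration, which moves the points by less than [r]. *)
Lemma chart_shadowing : asymptotic_shadowing d f.
Proof.
have [B B0 hB] := pseudo_orbit_impulses.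
have q0 : 0 < 1 / 4 :> R by [].
have [T [del1 [del10 hdel1]]] := hB _ q0.
have [Lam Lam0 hLam] := uniform_diff_bounded rho_img D f_C1.
pose K := (2 * T + 1)%:R * B.
have K0 : 0 < K by rewrite mulr_gt0 // ltr0n addn1.
pose theta := 1 / 4 / K.
have theta0 : 0 < theta by rewrite !divr_gt0.
have [r1 r10 hr1] := uniform_diff_close rho_img D f_C1 theta0.
move=> e e0.
have [r2 r20 hr2] := uniform_chart_inv_close rho_img D d_metric e0.
pose r := Num.min r1 r2.
have r0 : 0 < r by rewrite lt_min r10.
have rr1 : r <= r1 by rewrite ge_min lexx.
have rr2 : r <= r2 by rewrite ge_min lexx orbT.
pose del := r / (4 * K).
have K40 : 0 < 4 * K by rewrite mulr_gt0.
have del0 : 0 < del by rewrite divr_gt0.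
have Kdel : 2 * K * del < r.
  have -> : 2 * K * del = r / 2 by rewrite /del; field; rewrite gt_eqF.
  by rewrite ltr_pdivrMr // ltr_pMr // ltr1n.
have [e1 e10 he1] := close_core del0.
exists (Num.min del1 e1); first by rewrite lt_min del10.
move=> x px.
have px1 : pseudo_orbit d f del1 x.
  by move=> i; apply: lt_le_trans (px i) _; rewrite ge_min lexx.
pose k i := loc (x i).
have fclose i : core2 (k (i + 1)) (f (x i)) /\
    `|ch (k (i + 1)) (x (i + 1)) - ch (k (i + 1)) (f (x i))| < del.
  apply: (he1 (x (i + 1)) _ (loc_D _) (loc_core _) _ _).
  rewrite (dist_sym d_metric); apply: lt_le_trans (px i) _.
  by rewrite ge_min lexx orbT.
have T20 : 0 < (2 * T + 2)%:R :> R by rewrite ltr0n addn2.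
have tau0 : 0 <= 1 / 4 / (2 * T + 2)%:R :> R by rewrite ltW // !divr_gt0.
have [G [G_bd G_inv G_loc]] := assemble_impulses (ltW B0) tau0 (hdel1 x px1).
pose phi i := in_charts (ch (k i)) (ch (k (i + 1))) f.
pose xi i := ch (k i) (x i).
have phi_xi i : phi i (xi i) = ch (k (i + 1)) (f (x i)).
  by rewrite /phi /xi /in_charts /= chart_mapK //; case: (loc_core (x i)).
have near_xi i y : `|y - xi i| < r1 ->
  [/\ chart_img (ch (k i)) y, chart_dom (ch (k (i + 1))) (f (chart_inv (ch (k i)) y)),
    differentiable (phi i) y &
    forall v, `|'d (phi i) y v - 'd (phi i) (xi i) v| <= theta * `|v|].
  exact: (hr1 _ _ (loc_D (x i)) (loc_D (x (i + 1))) _ (loc_core2 _) (fclose i).1).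
have H1 i : exists L, forall v, `|chart_cocycle X f k x i v| <= L * `|v|.
  exists Lam => v.
  exact: (hLam _ _ (loc_D (x i)) (loc_D (x (i + 1))) _ (loc_core2 _) (fclose i).1).
have H2 i y z : `|y - xi i| < r -> `|z - xi i| < r ->
    `|phi i y - phi i z - chart_cocycle X f k x i (y - z)| <= theta * `|y - z|.
  move=> yr zr; apply: (mean_value_approx (ltW theta0) (r := r)) => //.
    by move=> w wr; case: (near_xi i w (lt_le_trans wr rr1)).
  by move=> w wr; case: (near_xi i w (lt_le_trans wr rr1)).
have H4 h eta : (forall i, `|h i| <= eta) ->
    forall i, `|G h (i + 1) - chart_cocycle X f k x i (G h i) - h i| <= eta / 4.
  move=> hb i; apply: le_trans (G_inv h eta hb i) _.
  have -> : (2 * T + 2)%:R * (1 / 4 / (2 * T + 2)%:R * eta) = eta / 4.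
    by field; rewrite gt_eqF.
  by [].
have H8 : K * theta <= 1 / 4.
  by rewrite /theta mulrC divfK // gt_eqF.
have H9 i : `|phi i (xi i) - xi (i + 1)| <= del.
  by rewrite phi_xi distrC; exact: ltW (fclose i).2.
have [zeta [z_orb z_near z_loc]] := newton_shadowing
  (A := fun i v => chart_cocycle X f k x i v) H1 H2 G_bd H4 G_loc
  (ltW K0) (ltW del0) (ltW theta0) H8 Kdel H9.
pose z i := chart_inv (ch (k i)) (zeta i).
have zr i : `|zeta i - xi i| < r by apply: le_lt_trans (z_near i) Kdel.
have oz : is_orbit f z.
  move=> i; have [_ h _ _] := near_xi i (zeta i) (lt_le_trans (zr i) rr1).
  rewrite /z -z_orb /phi /in_charts /= chart_mapK //.
have dist_small eta : 0 < eta -> exists N : nat, forall i : int,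
    (forall j : int, (`|j - i| <= N * T.+1)%N -> f (x j) = x (j + 1)) -> d (x i) (z i) < eta.
  move=> eta0; have [s s0 hs] := uniform_chart_inv_close rho_img D d_metric eta0.
  have [N hN] : exists N : nat, forall n, (N <= n)%N -> 2 * K * del * 2^-1 ^+ n < s.
    by apply: geometric_small => //; rewrite invr_ge0 ler0n invf_lt1 // ltr1n.
  exists N => i hi.
  apply: (hs _ (loc_D (x i)) (x i) (loc_core2 _) (zeta i) _).2.
  apply: le_lt_trans (hN N (leqnn N)); apply: z_loc => j ji.
  by rewrite phi_xi hi.
exists z; split.
- exact: oz.
- by move=> i; apply: (hr2 _ (loc_D (x i)) (x i) (loc_core2 _) (zeta i) (lt_le_trans (zr i) rr2)).2.
- move=> i0 hi0 eta eta0; have [N hN] := dist_small eta eta0.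
  exists (i0 + (N * T.+1)%N%:Z) => i ii; apply: hN => j ji; apply: hi0.
  by clear -ii ji; lia.
- move=> i0 hi0 eta eta0; have [N hN] := dist_small eta eta0.
  exists (i0 - (N * T.+1)%N%:Z) => i ii; apply: hN => j ji; apply: hi0.
  by clear -ii ji; lia.
Qed.

End AnosovShadowing.

Section Conclusion.
Context {R : realType} {m : nat} {M : topologicalType}.
Variable X : smooth_manifold R m M.
Variable f : M -> M.
Hypothesis M_compact : compact [set: M].

Lemma anosov_asymptotic_shadowing (g : riemannian_metric X) (d : M -> M -> R) :
  anosov_endomorphism g f -> (forall y, exists x, f x = y) -> compatible_metric d ->
  asymptotic_shadowing d f.
Proof.
move=> fA fs dm.
have [rho hrho] := chart_radius X.
have rho0 p : 0 < rho p by case: (hrho p).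
have rhoi p : forall y, `|y - chart_at X p p| <= 2 * rho p -> chart_img (chart_at X p) y.
  by case: (hrho p).
have [D hD] := finite_atlas X M_compact rho0.
have /choice[loc hloc] : forall x, exists p, p \in D /\ core X rho 1 p x.
  by move=> x; have [p] := hD x; exists p.
apply: (chart_shadowing M_compact fA fs dm rho0 rhoi (D := D) (loc := loc)).
  by move=> x; case: (hloc x).
by move=> x; case: (hloc x).
Qed.

(** The image is open because [f] is a local homeomorphism, and compact. *)
Lemma local_diffeomorphism_surjective : connected [set: M] -> C1_on X setT f ->
  local_C1_diffeomorphism X f -> forall y, exists x, f x = y.
Proof.
move=> M_conn fC1 fdiff y.
have f_cont : continuous f by move=> x; exact: fC1.1.
suff E : range f = setT.
  have [x _ fx] : range f y by rewrite E.
  by exists x.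
apply: clopen_setT => //.
- by exists (f y), y.
- rewrite openE => _ [x _ <-].
  have [U [h [[_ Ux] ofU _ _ _]]] := fdiff x.
  apply: (@filterS _ _ _ (f @` U)); first by move=> _ [w _ <-]; exists w.
  by apply: open_nbhs_nbhs; split => //; exists x.
- apply: compact_closed; first exact: (manifold_hausdorff X).
  apply: continuous_compact => //; exact: continuous_subspaceT.
Qed.

End Conclusion.


Theorem corollary2p1 (R : realType) (m : nat) (M : topologicalType)
    (X : smooth_manifold R m M) (g : riemannian_metric X) (f : M -> M)
    (M_compact : compact [set: M]) (M_connected : connected [set: M])
    (f_anosov : anosov_endomorphism g f)
    (Omega_invariant : completely_invariant f (nonwandering f)) :
  (boundary (nonwandering f) = nonwandering f \/
   boundary (nonwandering f) = set0) /\
  (boundary (nonwandering f) = set0 -> transitive_map f).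
Proof.
have [f_C1 f_diff _] := f_anosov.
have f_surj := local_diffeomorphism_surjective M_compact M_connected f_C1 f_diff.
have [d d_metric] := manifold_metric X M_compact.
have f_cont : continuous f by move=> x; exact: f_C1.1.
apply: (nonwandering_dichotomy d_metric f_cont f_surj _ M_connected Omega_invariant M_compact).
exact: (anosov_asymptotic_shadowing M_compact f_anosov f_surj d_metric).
Qed.
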